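(* Let $0<\alpha<1/2$ and $\overline\lambda=\kappa\underline\lambda>\underline\lambda\ge c$ for a constant $c>0$. Consider data $\mathcal D=\{(Y_1,\mathcal X_1),\dots,(Y_n,\mathcal X_n)\}$ from the tensor regression model $Y_i=\langle\mathcal T,\mathcal X_i\rangle+\xi_i$, where the $\xi_i$ are i.i.d. $N(0,\sigma_\xi^2)$ and the design tensors $\mathcal X_i\in\mathbb R^{p_1\times p_2\times p_3}$ are i.i.d. with i.i.d. $N(0,\sigma^2)$ entries. Let $\mathcal A\in\mathbb R^{p_1\times p_2\times p_3}$ be a loading tensor. Then there exists a constant $c_3>0$ such that, for every signal tensor $\mathcal T=\mathcal G\times_1U_1\times_2U_2\times_3U_3\in\Theta(\underline\lambda,\kappa)$, $$\inf_{\mathrm{CI}\in\mathcal I_\alpha(\Theta,\mathcal A)}\ \sup_{\mathcal T'\in\Theta(\underline\lambda,\kappa)}\mathbb E_{\mathcal T'}\,L(\mathrm{CI}(\mathcal D))\ \ge\ \frac{c_3\sigma_\xi}{\sigma\sqrt n}\sqrt{\sum_{j=1}^3\|\mathcal P_{U_{j\perp}}A_j\mathcal P_{(U_{j+2}\otimes U_{j+1})G_j^\top}\|_{\mathrm F}^2+\|\mathcal A\times_1U_1^\top\times_2U_2^\top\times_3U_3^\top\|_{\mathrm F}^2},$$ where $L(\cdot)$ denotes the length of a confidence interval.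
   Context: Mode indices are modulo 3. $\mathrm{Mat}_j(\mathcal M)\in\mathbb R^{p_j\times p_{j+2}p_{j+1}}$ is the mode-$j$ matricization, $[\mathrm{Mat}_j(\mathcal M)]_{k_j,k_{j+1}+p_{j+1}(k_{j+2}-1)}=\mathcal M_{k_1,k_2,k_3}$; $\times_j$ is the mode-$j$ product, $\mathrm{Mat}_j(\mathcal M\times_jV)=V\mathrm{Mat}_j(\mathcal M)$; $\otimes$ is the Kronecker product; $A_j=\mathrm{Mat}_j(\mathcal A)$, $G_j=\mathrm{Mat}_j(\mathcal G)$. $\mathbb O^{p\times r}$ is the set of $p\times r$ matrices with orthonormal columns; $\mathcal P_M$ is the orthogonal projection onto the column space of $M$; $\mathcal P_{U_\perp}=I-UU^\top$ for $U\in\mathbb O^{p\times r}$. The parameter space is $$\Theta=\Theta(\underline\lambda,\kappa)=\{\mathcal T=\mathcal G\times_1U_1\times_2U_2\times_3U_3:\ \mathcal G\in\mathbb R^{r_1\times r_2\times r_3},\ U_j\in\mathbb O^{p_j\times r_j},\ \underline\lambda\le\lambda\le\kappa\underline\lambda\},$$ where $\lambda$ ranges over all nonzero singular values of $\mathrm{Mat}_j(\mathcal T)$, $j=1,2,3$. The loading tensor $\mathcal A$ has the form $\mathcal B\times_1V_1\times_2V_2\times_3V_3$ with $\mathcal B\in\mathbb R^{R_1\times R_2\times R_3}$, $V_j\in\mathbb O^{p_j\times R_j}$ (full rank $R_j=p_j$ allowed). $\mathcal I_\alpha(\Theta,\mathcal A)$ is the class of data-dependent intervals $\mathrm{CI}(\mathcal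 D)=[l(\mathcal D),u(\mathcal D)]$ with $\inf_{\mathcal T\in\Theta}\mathbb P_{\mathcal T}(l(\mathcal D)\le\langle\mathcal T,\mathcal A\rangle\le u(\mathcal D))\ge1-\alpha$. *)

(* Defs.v *)
From HB Require Import structures.
From mathcomp Require Import all_boot all_order all_algebra.
From mathcomp Require Import mxtens.
From mathcomp Require Import all_classical all_reals all_analysis.

Set Implicit Arguments.
Unset Strict Implicit.
Unset Printing Implicit Defensive.

Import Order.TTheory GRing.Theory Num.Theory.

Local Open Scope classical_set_scope.
Local Open Scope ring_scope.

Definition tensor (R : Type) (p1 p2 p3 : nat) : Type :=
  {ffun 'I_p1 * 'I_p2 * 'I_p3 -> R}.

Section TensorAlgebra.
Context {R : realType}.
Implicit Types p r m n : nat.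

(* [mxtens_index (a, b)] is [a * p_{j+1} + b], so the columns of [matj] are
   numbered by (k_{j+2}, k_{j+1}) with k_{j+1} varying fastest. *)
Definition mat1 p1 p2 p3 (M : tensor R p1 p2 p3) : 'M[R]_(p1, p3 * p2) :=
  \matrix_(k, c) M (k, (mxtens_unindex c).2, (mxtens_unindex c).1).

Definition mat2 p1 p2 p3 (M : tensor R p1 p2 p3) : 'M[R]_(p2, p1 * p3) :=
  \matrix_(k, c) M ((mxtens_unindex c).1, k, (mxtens_unindex c).2).

Definition mat3 p1 p2 p3 (M : tensor R p1 p2 p3) : 'M[R]_(p3, p2 * p1) :=
  \matrix_(k, c) M ((mxtens_unindex c).2, (mxtens_unindex c).1, k).

Definition mode1 p1 p2 p3 q (M : tensor R p1 p2 p3) (V : 'M[R]_(q, p1)) :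
  tensor R q p2 p3 := [ffun k => \sum_i V k.1.1 i * M (i, k.1.2, k.2)].

Definition mode2 p1 p2 p3 q (M : tensor R p1 p2 p3) (V : 'M[R]_(q, p2)) :
  tensor R p1 q p3 := [ffun k => \sum_i V k.1.2 i * M (k.1.1, i, k.2)].

Definition mode3 p1 p2 p3 q (M : tensor R p1 p2 p3) (V : 'M[R]_(q, p3)) :
  tensor R p1 p2 q := [ffun k => \sum_i V k.2 i * M (k.1.1, k.1.2, i)].

Lemma mat1_mode1 p1 p2 p3 q (M : tensor R p1 p2 p3) (V : 'M[R]_(q, p1)) :
  mat1 (mode1 M V) = V *m mat1 M.
Proof.
by apply/matrixP => i j; rewrite !mxE ffunE; apply: eq_bigr => k _; rewrite mxE.
Qed.

Lemma mat2_mode2 p1 p2 p3 q (M : tensor R p1 p2 p3) (V : 'M[R]_(q, p2)) :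
  mat2 (mode2 M V) = V *m mat2 M.
Proof.
by apply/matrixP => i j; rewrite !mxE ffunE; apply: eq_bigr => k _; rewrite mxE.
Qed.

Lemma mat3_mode3 p1 p2 p3 q (M : tensor R p1 p2 p3) (V : 'M[R]_(q, p3)) :
  mat3 (mode3 M V) = V *m mat3 M.
Proof.
by apply/matrixP => i j; rewrite !mxE ffunE; apply: eq_bigr => k _; rewrite mxE.
Qed.

Definition tucker p1 p2 p3 r1 r2 r3 (G : tensor R r1 r2 r3)
    (U1 : 'M[R]_(p1, r1)) (U2 : 'M[R]_(p2, r2)) (U3 : 'M[R]_(p3, r3)) :
  tensor R p1 p2 p3 := mode3 (mode2 (mode1 G U1) U2) U3.

Definition tdot p1 p2 p3 (T A : tensor R p1 p2 p3) : R := \sum_k T k * A k.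

Definition tnormF p1 p2 p3 (T : tensor R p1 p2 p3) : R :=
  Num.sqrt (\sum_k T k ^+ 2).

Definition mxnormF m n (M : 'M[R]_(m, n)) : R :=
  Num.sqrt (\sum_i \sum_j M i j ^+ 2).

Definition orthonormal_cols p r (U : 'M[R]_(p, r)) : Prop := U^T *m U = 1%:M.

Definition nonzero_singular_value m n (M : 'M[R]_(m, n)) (s : R) : Prop :=
  0 < s /\ eigenvalue (M *m M^T) (s ^+ 2).

(* The row space of [M^T] is the column space of [M] and that of [kermx M] is
   its orthogonal complement; [orth_projP] shows that this is the usual
   (symmetric, idempotent) matrix of the orthogonal projection. *)
Definition orth_proj m n (M : 'M[R]_(m, n)) : 'M[R]_m :=
  proj_mx << M^T >>%MS (kermx M).

Definition orth_compl_proj p r (U : 'M[R]_(p, r)) : 'M[R]_p := 1%:M - U *m U^T.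

Lemma cap_col_kermx m n (M : 'M[R]_(m, n)) : (<< M^T >> :&: kermx M)%MS = 0.
Proof.
apply/eqP/rowV0P => v; rewrite sub_capmx genmxE => /andP[/submxP[w ->]].
rewrite sub_kermx => /eqP wMM.
have : (w *m M^T) *m (w *m M^T)^T = 0.
  by rewrite trmx_mul trmxK mulmxA wMM mul0mx.
move=> /matrixP /(_ 0 0); rewrite !mxE => h0.
have {h0} /psumr_eq0P h : \sum_j (w *m M^T) 0 j ^+ 2 = 0.
  by rewrite -[RHS]h0; apply: eq_bigr => j _; rewrite [X in _ * X]mxE expr2.
apply/rowP => i; rewrite [RHS]mxE; apply/eqP; rewrite -sqrf_eq0.
by rewrite h// => j _; exact: sqr_ge0.
Qed.

Lemma orth_projP m n (M : 'M[R]_(m, n)) :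
  [/\ (orth_proj M)^T = orth_proj M,
      orth_proj M *m orth_proj M = orth_proj M,
      orth_proj M *m M = M &
      ((orth_proj M)^T <= M^T)%MS].
Proof.
set P := orth_proj M.
have cap := cap_col_kermx M.
have PM : P *m M = M.
  have full : ((1%:M : 'M[R]_m) <= << M^T >> + kermx M)%MS.
    rewrite sub1mx /row_full (mxrank_disjoint_sum cap) genmxE mxrank_tr.
    by rewrite mxrank_ker subnKC ?rank_leq_row.
  have e := add_proj_mx cap full.
  rewrite !mul1mx in e.
  have : (proj_mx (kermx M) << M^T >>%MS <= kermx M)%MS.
    by rewrite -[X in (X <= _)%MS]mul1mx proj_mx_sub.
  rewrite sub_kermx => /eqP kM.
  by rewrite -[RHS]mul1mx -e mulmxDl kM addr0.
have PS : (P <= M^T)%MS.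
  by rewrite -[P]mul1mx (submx_trans (proj_mx_sub _ _ _)) ?genmxE.
have PPt : P *m P^T = P^T.
  have /submxP[D PE] := PS.
  have -> : P^T = M *m D^T by rewrite PE trmx_mul trmxK.
  by rewrite mulmxA PM.
have Psym : P^T = P.
  by have := congr1 trmx PPt; rewrite trmx_mul !trmxK PPt.
split=> //; last by rewrite Psym.
by rewrite -[X in _ *m X]Psym PPt.
Qed.

Definition Theta p1 p2 p3 r1 r2 r3 (lam kappa : R) : set (tensor R p1 p2 p3) :=
  [set T | (exists (G : tensor R r1 r2 r3) (U1 : 'M[R]_(p1, r1))
              (U2 : 'M[R]_(p2, r2)) (U3 : 'M[R]_(p3, r3)),
              [/\ orthonormal_cols U1, orthonormal_cols U2,
                  orthonormal_cols U3 & T = tucker G U1 U2 U3]) /\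
           (forall s, nonzero_singular_value (mat1 T) s \/
                      nonzero_singular_value (mat2 T) s \/
                      nonzero_singular_value (mat3 T) s ->
                      lam <= s <= kappa * lam)].

Definition is_loading_tensor R1 R2 R3 p1 p2 p3 (A : tensor R p1 p2 p3) : Prop :=
  exists (B : tensor R R1 R2 R3) (V1 : 'M[R]_(p1, R1))
    (V2 : 'M[R]_(p2, R2)) (V3 : 'M[R]_(p3, R3)),
    [/\ orthonormal_cols V1, orthonormal_cols V2, orthonormal_cols V3 &
        A = tucker B V1 V2 V3].

(* P_{U_perp} A_j P_{(V (x) W) G_j^T}, with U, V, W the loadings of modes
   j, j+2, j+1. *)
Definition mode_component p r q2 s2 q1 s1
    (U : 'M[R]_(p, r)) (V : 'M[R]_(q2, s2)) (W : 'M[R]_(q1, s1))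
    (Aj : 'M[R]_(p, q2 * q1)) (Gj : 'M[R]_(r, s2 * s1)) : 'M[R]_(p, q2 * q1) :=
  orth_compl_proj U *m Aj *m orth_proj (tensmx V W *m Gj^T).

Definition tangent_norm p1 p2 p3 r1 r2 r3 (G : tensor R r1 r2 r3)
    (U1 : 'M[R]_(p1, r1)) (U2 : 'M[R]_(p2, r2)) (U3 : 'M[R]_(p3, r3))
    (A : tensor R p1 p2 p3) : R :=
  Num.sqrt (mxnormF (mode_component U1 U3 U2 (mat1 A) (mat1 G)) ^+ 2
          + mxnormF (mode_component U2 U1 U3 (mat2 A) (mat2 G)) ^+ 2
          + mxnormF (mode_component U3 U2 U1 (mat3 A) (mat3 G)) ^+ 2
          + tnormF (tucker A U1^T U2^T U3^T) ^+ 2).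

End TensorAlgebra.

Arguments Theta {R p1 p2 p3} r1 r2 r3 lam kappa.

(* The entry cylinders generate the Borel sigma-algebra of R^{p1 x p2 x p3}. *)
Definition tensor_display : measure_display.
Proof. exact: default_measure_display. Qed.

Section MeasurableTensor.
Context (R : realType) (p1 p2 p3 : nat).

HB.instance Definition _ := Choice.copy (tensor R p1 p2 p3)
  {ffun 'I_p1 * 'I_p2 * 'I_p3 -> R}.
HB.instance Definition _ := isPointed.Build (tensor R p1 p2 p3) [ffun=> 0].

Definition entry_cylinders : set (set (tensor R p1 p2 p3)) :=
  [set C | exists (k : 'I_p1 * 'I_p2 * 'I_p3) (B : set R),
     measurable B /\ C = [set T : tensor R p1 p2 p3 | B (T k)]].

Let tensor_set0 : <<s entry_cylinders >> set0.
Proof. exact: sigma_algebra0. Qed.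

Let tensor_setC A : <<s entry_cylinders >> A -> <<s entry_cylinders >> (~` A).
Proof. exact: sigma_algebraC. Qed.

Let tensor_bigcup (F : (set (tensor R p1 p2 p3))^nat) :
  (forall i, <<s entry_cylinders >> (F i)) ->
  <<s entry_cylinders >> (\bigcup_i F i).
Proof. exact: sigma_algebra_bigcup. Qed.

HB.instance Definition _ := @isMeasurable.Build tensor_display
  (tensor R p1 p2 p3) <<s entry_cylinders >>
  tensor_set0 tensor_setC tensor_bigcup.

End MeasurableTensor.

Section RandomVariables.
Context {R : realType} {d : measure_display} {Omega : measurableType d}.
Variable P : probability Omega R.

Definition normally_distributed (Z : Omega -> R) (m s : R) : Prop :=
  forall B : set R, measurable B -> P (Z @^-1` B) = normal_prob m s B.

Definition mutually_independent (I : finType) (Z : I -> Omega -> R) : Prop :=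
  forall (J : {set I}) (B : I -> set R), (forall i, measurable (B i)) ->
    P (\bigcap_(i in [set` J]) Z i @^-1` B i) =
    (\prod_(i in J) fine (P (Z i @^-1` B i)))%:E.

End RandomVariables.

Section TensorRegression.
Context {R : realType} {p1 p2 p3 n : nat}.

Record interval_estimator := IntervalEstimator {
  lower : {mfun n.-tuple (R * tensor R p1 p2 p3)%type >-> R};
  upper : {mfun n.-tuple (R * tensor R p1 p2 p3)%type >-> R};
  lower_le_upper : forall D, lower D <= upper D }.

Definition ci_length (CI : interval_estimator)
    (D : n.-tuple (R * tensor R p1 p2 p3)) : R :=
  upper CI D - lower CI D.

Context {d : measure_display} {Omega : measurableType d}.
Variable P : probability Omega R.
Variables (X : 'I_n -> {RV P >-> tensor R p1 p2 p3}) (xi : 'I_n -> {RV P >-> R}).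

(* Mutual independence of all the noises and all the design entries encodes
   at once that the noises are i.i.d., that the designs are i.i.d. with i.i.d.
   entries, and that the noise is independent of the design. *)
Definition gaussian_design_noise (sigma sigma_xi : R) : Prop :=
  [/\ forall i, normally_distributed P (xi i) 0 sigma_xi,
      forall i k, normally_distributed P (fun w => X i w k) 0 sigma &
      mutually_independent P
        (fun j : 'I_n + 'I_n * ('I_p1 * 'I_p2 * 'I_p3) =>
           match j with
           | inl i => fun w => xi i w
           | inr (i, k) => fun w => X i w k
           end)].

(* The distribution of these data under [P] is the law P_T of the model. *)
Definition regression_data (T : tensor R p1 p2 p3) (w : Omega) :
    n.-tuple (R * tensor R p1 p2 p3) :=
  [tuple (tdot T (X i w) + xi i w, X i w) | i < n].

Definition coverage (CI : interval_estimator) (A T : tensor R p1 p2 p3) : \bar R :=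
  P [set w | lower CI (regression_data T w) <= tdot T A
             <= upper CI (regression_data T w)].

Definition valid_cis (alpha : R) (Th : set (tensor R p1 p2 p3))
    (A : tensor R p1 p2 p3) : set interval_estimator :=
  [set CI | ((1 - alpha)%:E <= ereal_inf [set coverage CI A T | T in Th])%E].

Definition expected_length (CI : interval_estimator) (T : tensor R p1 p2 p3) :
  \bar R := 'E_P[fun w => ci_length CI (regression_data T w)]%E.

Definition minimax_expected_length (alpha : R) (Th : set (tensor R p1 p2 p3))
    (A : tensor R p1 p2 p3) : \bar R :=
  ereal_inf [set ereal_sup [set expected_length CI T | T in Th]
            | CI in valid_cis alpha Th A].

End TensorRegression.

(* Main.v *)
From HB Require Import structures.
Require Import Defs.
From mathcomp Require Import all_boot all_order all_algebra.
From mathcomp Require Import mxtens ring lra.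
From mathcomp Require Import all_classical all_reals all_analysis.
From mathcomp Require Import measurable_realfun.

(** Le Cam's two-point method. Put [eps = sigma_xi / (sigma * sqrt n)]. If two
    signals [T0], [T1] of the parameter space differ by a small multiple of [eps]
    times a unit tensor, their data laws are close in total variation, so an
    interval that covers [<T, A>] with probability [1 - alpha > 1/2] under both
    must contain both values with positive probability under [T0]
    ([two_point_expected_length]). Its mean length is then at least a constant
    times [`|<T1 - T0, A>|].

    It is enough to use rank-one signals. The parameter space constrains the
    nonzero singular values only, hence contains [s u (x) v (x) w] for unit
    columns [u], [v], [w] of any three frames and [lam <= s <= kappa * lam]
    ([rank_one_Theta]). Increasing [s] from [lam] by [a * eps], which the
    hypotheses allow for a constant [a], gives the lower bound
    [eps * `|<A, u (x) v (x) w>|] up to a constant. Each term of the tangent norm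
    is controlled by such pairings ([tangent_norm_le]). The entries of [A]
    multiplied by the transposed frames are pairings with columns of the given
    frames. In a mode component, contract [A] with one column of each of the two
    other frames and project the resulting vector off the frame of the mode: once
    normalized, the projection can replace a column of that frame, and its norm
    is the pairing of [A] with the resulting rank-one tensor. The number of
    pairings depends on the ranks only.

    For the total variation, moving the signal by [tau e] moves the noise of
    observation [i] by [tau <e, X_i>], a function of the design. As noise and
    design are independent Gaussian, a shift of some coordinates by functions of
    the others has an explicit likelihood ratio ([shift_law]), proved one
    coordinate at a time: a coordinate may be resampled from its own law
    ([resample]), which reduces to the one-dimensional Cameron-Martin formula
    ([integral_normal_shift]). The Hellinger affinity is computed by the same
    formula: the root of the likelihood ratio is the likelihood ratio of half the
    shift times [exp (- sum_i tau^2 <e, X_i>^2 / (8 sigma_xi^2))], so that one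
    minus the affinity is at most
    [sum_i tau^2 E <e, X_i>^2 / (8 sigma_xi^2)], of order [n tau^2 sigma^2 /
    sigma_xi^2] ([hellinger_affinity]). *)

Set Implicit Arguments.
Unset Strict Implicit.
Unset Printing Implicit Defensive.

Import Order.TTheory GRing.Theory Num.Theory.
Local Open Scope classical_set_scope.
Local Open Scope ring_scope.

(** * Shifting a one-dimensional Gaussian *)

Section GaussianShift.
Context {R : realType}.
Local Notation leb := (@lebesgue_measure R).

(** The density of [N(h, s^2)] with respect to [N(0, s^2)]. *)
Definition shift_ratio (s x h : R) : R := expR ((x * h - h ^+ 2 / 2) / s ^+ 2).

Lemma ge0_integral_normal_prob (m s : R) (f : R -> \bar R) :
  measurable_fun setT f -> (forall x, 0 <= f x)%E ->
  (\int[normal_prob m s]_x f x = \int[leb]_x (f x * (normal_pdf m s x)%:E))%E.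
Proof.
move=> mf f0; have dom := normal_prob_dominates m s.
rewrite -(Radon_Nikodym_SigmaFinite.change_of_variables dom f0 measurableT)//.
have mpdf : measurable_fun setT (EFin \o normal_pdf m s).
  by apply/measurable_EFinP; exact: measurable_normal_pdf.
have irn := Radon_Nikodym_SigmaFinite.f_integrable dom.
have mrn := measurable_int _ irn.
apply: ae_eq_integral => //; [exact: emeasurable_funM|exact: emeasurable_funM|].
apply: ae_eqe_mul2l; apply: integral_ae_eq => // E _ mE.
by rewrite -Radon_Nikodym_SigmaFinite.f_integral.
Qed.

Lemma lebesgue_measure_translation (h : R) (A : set R) : measurable A ->
  pushforward leb ((fun x => x + h) : _ -> measurableTypeR R) A = leb A.
Proof.
move=> mA; apply/esym/lebesgue_measure_unique => //=.
  exact: measurable_funD.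
move=> _ _ [[a b]] _ <-.
rewrite /pushforward/= (_ : _ @^-1` _ = `]a - h, b - h]%classic); last first.
  by apply/seteqP; split => x /=; rewrite !in_itv/= ltrBlDr lerBrDr.
rewrite !lebesgue_measure_itv/= !lte_fin ltrD2r -!EFinB.
by rewrite opprB addrA subrK.
Qed.

Lemma ge0_integral_translation (h : R) (f : R -> \bar R) :
  measurable_fun setT f -> (forall x, 0 <= f x)%E ->
  (\int[leb]_x f ((x : R) + h)%R = \int[leb]_x f x)%E.
Proof.
move=> mf f0; have mh : measurable_fun setT (fun x : R => x + h).
  exact: measurable_funD.
transitivity (\int[pushforward leb
    ((fun x : R => x + h)%R : _ -> measurableTypeR R)]_x f x)%E.
  by rewrite ge0_integral_pushforward.
by apply: eq_measure_integral => A mA _; exact: lebesgue_measure_translation.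
Qed.

Lemma normal_pdf_shift (s x h : R) : s != 0 ->
  normal_pdf 0 s (x - h) = shift_ratio s x h * normal_pdf 0 s x.
Proof.
move=> s0; rewrite !normal_pdfE// /normal_fun mulrCA -expRD; congr (_ * expR _).
by rewrite -[s ^+ 2 *+ 2]mulr_natr; field.
Qed.

Lemma measurable_shift_ratio d (T : measurableType d) (s : R) (f g : T -> R) :
  measurable_fun setT f -> measurable_fun setT g ->
  measurable_fun setT (fun t => shift_ratio s (f t) (g t)).
Proof.
move=> mf mg; apply: measurableT_comp => //; apply: measurable_funM => //.
apply: measurable_funB; first exact: measurable_funM.
by apply: measurable_funM => //; exact: measurable_funX.
Qed.

(** Cameron-Martin in dimension one: Lebesgue measure is translation invariant
    and the shifted density is the density times [shift_ratio]. *)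
Lemma integral_normal_shift (s h : R) (f : R -> \bar R) : s != 0 ->
  measurable_fun setT f -> (forall x, 0 <= f x)%E ->
  (\int[normal_prob 0 s]_x f ((x : R) + h)%R =
   \int[normal_prob 0 s]_x (f x * (shift_ratio s x h)%:E))%E.
Proof.
move=> s0 mf f0.
have mh (c : R) : measurable_fun setT (fun x : R => x + c) by exact: measurable_funD.
have mr : measurable_fun setT (fun x : R => (shift_ratio s x h)%:E).
  by apply/measurable_EFinP; exact: measurable_shift_ratio.
rewrite ge0_integral_normal_prob//; last exact: measurableT_comp.
rewrite ge0_integral_normal_prob//; last 2 first.
- exact: emeasurable_funM.
- by move=> x; rewrite mule_ge0// lee_fin expR_ge0.
transitivity (\int[leb]_x
    (fun y : R => f y * (normal_pdf 0 s (y - h))%:E) ((x : R) + h)%R)%E.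
  by apply: eq_integral => x _ /=; rewrite addrK.
rewrite (@ge0_integral_translation h (fun y => f y * (normal_pdf 0 s (y - h))%:E)%E).
- by apply: eq_integral => x _; rewrite normal_pdf_shift// EFinM muleA.
- apply: emeasurable_funM => //; apply/measurable_EFinP.
  by apply: measurableT_comp => //; exact: measurable_normal_pdf.
- by move=> x; rewrite mule_ge0// lee_fin normal_pdf_ge0.
Qed.

End GaussianShift.

Section Law.
Context d1 d2 (T1 : measurableType d1) (T2 : measurableType d2) (R : realType).

(** Change of variables for a measure [m2] that is only known to agree with the
    image measure on measurable sets. *)
Lemma ge0_integral_law (m1 : {measure set T1 -> \bar R})
    (m2 : {measure set T2 -> \bar R}) (phi : T1 -> T2) (f : T2 -> \bar R) :
  measurable_fun setT phi ->
  (forall A, measurable A -> m2 A = m1 (phi @^-1` A)) ->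
  measurable_fun setT f -> (forall y, 0 <= f y)%E ->
  (\int[m2]_y f y = \int[m1]_x f (phi x))%E.
Proof.
move=> mphi m21 mf f0; rewrite -[RHS]/(\int[m1]_(x in phi @^-1` setT) (f \o phi) x)%E.
rewrite -ge0_integral_pushforward//.
by apply: eq_measure_integral => A mA _; exact: m21.
Qed.

End Law.

(** * Gaussian product measures and coordinate shifts *)

(** A copy of [J -> R] that carries the product sigma-algebra. *)
Definition cube (R : realType) (J : finType) : Type := J -> R.

HB.instance Definition _ (R : realType) (J : finType) :=
  Choice.copy (cube R J) (J -> R).
HB.instance Definition _ (R : realType) (J : finType) :=
  isPointed.Build (cube R J) (fun=> 0).

Definition box (R : realType) (J : finType) (B : J -> set R) : set (cube R J) :=
  [set z | forall j, B j (z j)].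

Definition boxes (R : realType) (J : finType) : set (set (cube R J)) :=
  [set box B | B in [set B | forall j, measurable (B j)]].

HB.instance Definition _ (R : realType) (J : finType) :=
  Measurable.copy (cube R J) (g_sigma_algebraType (@boxes R J)).

Section ProductGaussian.
Context {R : realType} {J : finType}.
Local Notation cube := (cube R J).

Definition update (j : J) (x : R) (z : cube) : cube :=
  fun i => if i == j then x else z i.

Lemma updateE j x z : update j x z j = x.
Proof. by rewrite /update eqxx. Qed.

Lemma update_neq j x z i : i != j -> update j x z i = z i.
Proof. by rewrite /update => /negbTE ->. Qed.

Lemma measurable_box (B : J -> set R) : (forall j, measurable (B j)) ->
  measurable (box B).
Proof. by move=> mB; apply: sub_sigma_algebra; exists B. Qed.

Lemma measurable_coordinate (j : J) :
  measurable_fun setT (fun z : cube => z j).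
Proof.
move=> _ B mB; rewrite setTI.
rewrite (_ : _ @^-1` _ = box (fun i => if i == j then B else setT)).
  by apply: measurable_box => i; case: ifP.
apply/seteqP; split=> z /=; rewrite /box /=.
  by move=> Bz i; case: eqP => // ->.
by move/(_ j); rewrite eqxx.
Qed.

Lemma measurable_to_cube d (T : measurableType d) (f : T -> cube) :
  (forall j, measurable_fun setT (fun t => f t j)) ->
  measurable_fun setT f.
Proof.
move=> mf; apply: (@measurability _ _ _ _ _ _ (@boxes R J)) => //.
move=> _ [_ [B mB <-] <-]; rewrite setTI.
rewrite (_ : _ @^-1` _ = \bigcap_(j in [set: J]) (fun t => f t j) @^-1` B j).
  apply: fin_bigcap_measurable; first exact: finite_finset.
  by move=> j _; rewrite -[X in measurable X]setTI; apply: mf => //; exact: mB.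
by apply/seteqP; split => t /= h j => [_|]; exact: h.
Qed.

Lemma measurable_update d (T : measurableType d) j (f : T -> R) (g : T -> cube) :
  measurable_fun setT f -> measurable_fun setT g ->
  measurable_fun setT (fun t => update j (f t) (g t)).
Proof.
move=> mf mg; apply: measurable_to_cube => i; rewrite /update /=.
by case: (i == j) => //; exact: (measurableT_comp (measurable_coordinate i) mg).
Qed.

Variables (s : J -> R) (mu : probability cube R).

Definition product_gaussian := forall B : J -> set R,
  (forall j, measurable (B j)) ->
  mu (box B) = (\prod_j fine (normal_prob 0 (s j) (B j)))%:E.

Hypothesis muE : product_gaussian.

(** The law of the point with coordinate [j] resampled agrees with [mu] on boxes,
    which form a generating pi-system. *)
Lemma resample (j : J) (f : cube -> \bar R) :
  measurable_fun setT f -> (forall z, 0 <= f z)%E ->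
  (\int[mu]_z f z =
   \int[mu]_z \int[normal_prob 0 (s j)]_x f (update j x z))%E.
Proof.
move=> mf f0.
pose N : probability (measurableTypeR R) R := normal_prob 0 (s j).
pose upd (p : measurableTypeR R * cube) : cube := update j p.1 p.2.
have mupd : measurable_fun setT upd 
  by exact: (measurable_update _ (@measurable_fst _ _ R cube) (@measurable_snd _ _ R cube)).
pose nu : {measure set (measurableTypeR R * cube) -> \bar R} := (N \x mu)%E.
rewrite (@ge0_integral_law _ _ _ _ _ nu mu upd)//.
  by rewrite /nu fubini_tonelli2//; exact: measurableT_comp.
move=> A mA; rewrite -[RHS]/(pushforward nu upd A).
have mG : @measurable _ cube = <<s @boxes R J >> by [].
apply: (@measure_unique _ _ _ (@boxes R J) (fun=> setT) mG) => //.
- move=> _ _ [B mB <-] [C mC <-]; exists (fun i => B i `&` C i).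
    by move=> i; exact: measurableI.
  apply/seteqP; split => z /= h; first by split=> i; case: (h i).
  by case: h => hB hC i; split; [exact: hB|exact: hC].
- by move=> _; exists (fun=> setT) => //; apply/seteqP; split.
- by apply/seteqP; split => // z _; exists 0%N.
- move=> _ [B mB <-].
  pose B' i := if i == j then setT else B i.
  have mB' i : measurable (B' i) by rewrite /B'; case: ifP.
  rewrite -[RHS]/(nu (upd @^-1` box B)).
  rewrite (_ : upd @^-1` box B = B j `*` box B').
    have -> : nu (B j `*` box B') = (N (B j) * mu (box B'))%E.
      by apply: product_measure1E; [exact: mB|exact: measurable_box].
    have -> : mu (box B') = (\prod_(i | i != j) fine (normal_prob 0 (s i) (B i)))%:E.
      rewrite muE// (bigD1 j)//= /B' eqxx probability_setT mul1r.
      by congr EFin; apply: eq_bigr => i /negbTE ->.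
    rewrite -[LHS]/(mu (box B)) muE// (bigD1 j)//= EFinM.
    by rewrite fineK// fin_num_measure//; exact: mB.
  apply/seteqP; split => -[x z] /=.
    move=> h; split=> [|i]; first by have := h j; rewrite /upd updateE.
    rewrite /B'; case: eqP => // /eqP ij.
    by have := h i; rewrite /upd update_neq.
  move=> [Bx Bz] i; rewrite /upd/= /update; have := Bz i; rewrite /B'.
  by case: eqP => // ->.
- by move=> _; rewrite -[X in (X < _)%E]/(mu setT) probability_setT ltry.
Qed.

Definition shift_coords (S : seq J) (h : J -> cube -> R) (z : cube) : cube :=
  fun i => if i \in S then z i + h i z else z i.

Lemma measurable_shift_coords S (h : J -> cube -> R) :
  (forall i, measurable_fun setT (h i)) -> measurable_fun setT (shift_coords S h).
Proof.
move=> mh; apply: measurable_to_cube => i; rewrite /shift_coords /=.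
case: (i \in S); last exact: measurable_coordinate.
by apply: measurable_funD => //; exact: measurable_coordinate.
Qed.

Lemma measurable_coordinate_ratio (i : J) (h : cube -> R) :
  measurable_fun setT h ->
  measurable_fun setT (fun z : cube => shift_ratio (s i) (z i) (h z)).
Proof.
by move=> mh; apply: measurable_shift_ratio => //; exact: measurable_coordinate.
Qed.

(** Resample coordinate [j], apply the one-dimensional formula with the other
    coordinates frozen, and resample backwards. *)
Lemma shift_one (j : J) (h : cube -> R) (f : cube -> \bar R) :
  s j != 0 -> measurable_fun setT h ->
  (forall x z, h (update j x z) = h z) ->
  measurable_fun setT f -> (forall z, 0 <= f z)%E ->
  (\int[mu]_z f (update j ((z : cube) j + h z)%R z) =
   \int[mu]_z (f z * (shift_ratio (s j) ((z : cube) j) (h z))%:E))%E.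
Proof.
move=> sj0 mh hj mf f0; have mj := measurable_coordinate j.
have mr := measurable_coordinate_ratio j mh.
rewrite [LHS](@resample j)//; last first.
  apply: (measurableT_comp mf).
  by apply: measurable_update => //; exact: measurable_funD.
rewrite [RHS](@resample j)//; last 2 first.
- by apply: emeasurable_funM => //; exact/measurable_EFinP.
- by move=> z; rewrite mule_ge0// lee_fin expR_ge0.
apply: eq_integral => z _.
transitivity (\int[normal_prob 0 (s j)]_x
    (fun y => f (update j y z)) ((x : R) + h z)%R)%E.
  apply: eq_integral => x _; congr f; apply/funext => i.
  by rewrite hj /update eqxx; case: eqP.
rewrite (@integral_normal_shift _ (s j) (h z) (fun y => f (update j y z)))//.
  by apply: eq_integral => x _; rewrite hj updateE.
apply: (measurableT_comp mf).
by apply: measurable_update.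
Qed.

(** Cameron-Martin for shifts that depend on the unshifted coordinates only.
    Coordinates are moved one after the other: since no [h i] sees a shifted
    coordinate, the amount of each move and the ratio of each coordinate are
    unaffected by the other moves. *)
Lemma shift_law (D : pred J) (h : J -> cube -> R) (S : seq J) (f : cube -> \bar R) :
  (forall i, s i != 0) -> (forall i, measurable_fun setT (h i)) ->
  (forall i z z', (forall k, ~~ D k -> z k = z' k) -> h i z = h i z') ->
  uniq S -> {subset S <= D} ->
  measurable_fun setT f -> (forall z, 0 <= f z)%E ->
  (\int[mu]_z f (shift_coords S h z) =
   \int[mu]_z (f z * (\prod_(i <- S) shift_ratio (s i) ((z : cube) i) (h i z))%:E))%E.
Proof.
move=> s0 mh hD; elim: S f => [|j S IH] f /=.
  move=> _ _ mf f0; apply: eq_integral => z _.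
  by rewrite big_nil mule1; congr f; apply/funext.
move=> /andP[jS uS] SD mf f0.
have jD : D j by apply: SD; rewrite inE eqxx.
have SD' : {subset S <= D} by move=> i iS; apply: SD; rewrite inE iS orbT.
have hupd i x z : h i (update j x z) = h i z.
  apply: hD => k kD; rewrite update_neq//; apply: contraNneq kD => ->.
  exact: jD.
have hshift i z : h i (shift_coords S h z) = h i z.
  apply: hD => k kD; rewrite /shift_coords ifN//; apply: contraNN kD => /SD'.
  by rewrite unfold_in.
transitivity (\int[mu]_z f (shift_coords S h (update j ((z : cube) j + h j z)%R z)))%E.
  apply: eq_integral => z _; congr f; apply/funext => i.
  rewrite /shift_coords inE hupd; have [->|ij] := eqVneq i j; last by rewrite update_neq.
  by rewrite (negbTE jS) updateE.
rewrite (@shift_one j (h j) (fun z => f (shift_coords S h z)))//; last first.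
  by apply: (measurableT_comp mf); exact: measurable_shift_coords.
have mr := measurable_coordinate_ratio j (mh j).
pose g z := (f z * (shift_ratio (s j) (z j) (h j z))%:E)%E.
transitivity (\int[mu]_z g (shift_coords S h z))%E.
  by apply: eq_integral => z _; rewrite /g hshift /shift_coords (negbTE jS).
rewrite IH//.
- by apply: eq_integral => z _; rewrite /g big_cons EFinM muleA.
- by apply: emeasurable_funM => //; exact/measurable_EFinP.
- by move=> z; rewrite mule_ge0// lee_fin expR_ge0.
Qed.

End ProductGaussian.

(** * Total variation from the Hellinger affinity *)

Section Hellinger.
Context d (T : measurableType d) (R : realType) (mu : probability T R).

Lemma integral_cst_probability (r : R) : (\int[mu]_(x in setT) r%:E = r%:E)%E.
Proof.
by rewrite integral_cst// -[X in (_ * X)%E]/(mu setT) probability_setT mule1.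
Qed.

(** With [Q ^+ 2] the likelihood ratio, AM-GM gives
    [1 - Q ^+ 2 <= (1 - Q) ^+ 2 / (2 b) + b (1 + Q) ^+ 2 / 2], and the integral
    of the right-hand side is controlled by the Hellinger affinity alone. *)
Lemma le_of_hellinger_affinity (Q : T -> R) (b : R) (E : set T) :
  0 < b < 1 -> measurable_fun setT Q -> (forall x, 0 <= Q x) ->
  (\int[mu]_x (Q x ^+ 2)%:E = 1)%E ->
  ((1 - b ^+ 2)%:E <= \int[mu]_x (Q x)%:E)%E -> measurable E ->
  (mu E <= \int[mu]_x ((\1_E x)%:E * (Q x ^+ 2)%:E) + (3 * b)%:E)%E.
Proof.
move=> /andP[b0 b1] mQ Q0 Q2 QE mE.
pose c := b^-1 - b; pose W x := (1 - Q x) ^+ 2 / (2 * b) + b * (1 + Q x) ^+ 2 / 2.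
have c0 : 0 <= c by rewrite subr_ge0 (le_trans (ltW b1))// invf_ge1// ltW.
have W0 x : 0 <= W x.
  apply: addr_ge0; apply: divr_ge0 => //; rewrite ?sqr_ge0// mulr_ge0 ?sqr_ge0//;
    exact: ltW.
have mQ2 : measurable_fun setT (fun x => Q x ^+ 2) by exact: measurable_funX.
have mW : measurable_fun setT W.
  apply: measurable_funD; apply: measurable_funM => //.
    by apply: measurable_funX; exact: measurable_funB.
  by apply: measurable_funM => //; apply: measurable_funX; exact: measurable_funD.
have mQe : measurable_fun setT (fun x => (Q x)%:E) by exact/measurable_EFinP.
have mQ2e : measurable_fun setT (fun x => (Q x ^+ 2)%:E) by exact/measurable_EFinP.
have mWe : measurable_fun setT (fun x => (W x)%:E) by exact/measurable_EFinP.
have Q0e x : setT x -> (0 <= (Q x)%:E)%E by rewrite lee_fin.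
have Q20e x : setT x -> (0 <= (Q x ^+ 2)%:E)%E by rewrite lee_fin sqr_ge0.
have W0e x : setT x -> (0 <= (W x)%:E)%E by rewrite lee_fin.
(* [W + c Q] is a multiple of [1 + Q ^+ 2], so its integral is known and only
   nonnegative functions have to be integrated. *)
have WQ : (\int[mu]_x (W x)%:E + c%:E * \int[mu]_x (Q x)%:E = (b^-1 + b)%:E)%E.
  rewrite -ge0_integralZl// -ge0_integralD//; last 2 first.
  - by move=> x _; rewrite mule_ge0// lee_fin.
  - exact: emeasurable_funM.
  pose e := (b^-1 + b) / 2.
  have e0 : 0 <= e by rewrite divr_ge0// addr_ge0// ?invr_ge0 ltW.
  transitivity (\int[mu]_x (e%:E + e%:E * (Q x ^+ 2)%:E))%E.
    apply: eq_integral => x _; rewrite -!EFinM -!EFinD; congr EFin.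
    by rewrite /W /c /e; field; rewrite gt_eqF.
  rewrite ge0_integralD//; last 2 first.
  - by move=> x _; rewrite mule_ge0// lee_fin// sqr_ge0.
  - exact: emeasurable_funM.
  rewrite ge0_integralZl// Q2 mule1 integral_cst_probability -EFinD.
  by congr EFin; rewrite /e; field; rewrite gt_eqF.
have W3b : (\int[mu]_x (W x)%:E <= (3 * b)%:E)%E.
  have cQ : ((c * (1 - b ^+ 2))%:E <= c%:E * \int[mu]_x (Q x)%:E)%E.
    by rewrite EFinM lee_wpmul2l// lee_fin.
  have : (\int[mu]_x (W x)%:E + (c * (1 - b ^+ 2))%:E <= (b^-1 + b)%:E)%E.
    by rewrite -WQ leeD2l.
  rewrite -leeBrDr//; move/le_trans; apply.
  rewrite -EFinB lee_fin /c.
  have -> : b^-1 + b - (b^-1 - b) * (1 - b ^+ 2) = 3 * b - b ^+ 3.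
    by field; rewrite gt_eqF.
  by rewrite gerBl exprn_ge0// ltW.
have m1 : measurable_fun setT (fun x => (\1_E x : R)%:E).
  by apply/measurable_EFinP; exact: measurable_indic.
have mL : measurable_fun setT (fun x => (\1_E x)%:E * (Q x ^+ 2)%:E)%E.
  by apply: emeasurable_funM => //; exact/measurable_EFinP.
have L0 x : (0 <= (\1_E x)%:E * (Q x ^+ 2)%:E)%E.
  by rewrite mule_ge0// lee_fin// sqr_ge0.
apply: (@le_trans _ _ (\int[mu]_x ((\1_E x)%:E * (Q x ^+ 2)%:E + (W x)%:E))%E).
  have -> : (mu E = \int[mu]_x (\1_E x)%:E)%E by rewrite integral_indic// setIT.
  apply: ge0_le_integral => //.
  - by apply: emeasurable_funD => //; exact/measurable_EFinP.
  - move=> x _; rewrite indicE; case: (x \in E) => /=; last first.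
      by rewrite mul0e add0e lee_fin.
    rewrite mul1e -EFinD lee_fin -subr_ge0.
    have -> : Q x ^+ 2 + W x - 1 =
        ((1 - Q x) - b * (1 + Q x)) ^+ 2 / (2 * b).
      by rewrite /W; field; rewrite gt_eqF.
    by rewrite divr_ge0// ?sqr_ge0// mulr_ge0// ltW.
by rewrite ge0_integralD// leeD2l.
Qed.

End Hellinger.

(** * Shifting the noise along the design *)

Section RegressionShift.
Context {R : realType} {n : nat} {K : finType}.
Local Notation J := ('I_n + 'I_n * K)%type.

Definition noise_or_design (sigma_xi sigma : R) (j : J) : R :=
  if j is inl _ then sigma_xi else sigma.

Definition design_score (e : K -> R) (i : 'I_n) (z : cube R J) : R :=
  \sum_k e k * z (inr (i, k)).

Lemma measurable_design_score e i : measurable_fun setT (design_score e i).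
Proof.
apply: measurable_sum => k; apply: measurable_funM => //.
exact: measurable_coordinate.
Qed.

Variables (sigma_xi sigma : R) (mu : probability (cube R J) R) (e : K -> R).
Hypotheses (sigma_xi_gt0 : 0 < sigma_xi) (sigma_gt0 : 0 < sigma).
Hypothesis muE : product_gaussian (noise_or_design sigma_xi sigma) mu.
Hypothesis e_unit : \sum_k e k ^+ 2 = 1.

Let s := noise_or_design sigma_xi sigma.

Let s_neq0 j : s j != 0.
Proof. by case: j => [i|ik]; rewrite gt_eqF. Qed.

(** The likelihood ratio of a constant shift of the design by [t * sigma ^+ 2 * e]
    is an exponential of the score; it integrates to one. *)
Lemma integral_expR_design_score i t :
  (\int[mu]_z (expR (t * design_score e i z))%:E =
   (expR ((t * sigma) ^+ 2 / 2))%:E)%E.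
Proof.
pose S : seq J := [seq inr (i, k) | k <- enum K].
pose c (j : J) (z : cube R J) : R := if j is inr ik then t * e ik.2 * sigma ^+ 2 else 0.
have uS : uniq S by rewrite map_inj_uniq ?enum_uniq// => k l [].
have mc j : measurable_fun setT (c j) by case: j => ?; exact: measurable_cst.
have cD (j : J) (z z' : cube R J) :
  (forall k, ~~ mem S k -> z k = z' k) -> c j z = c j z' by [].
have := shift_law muE s_neq0 mc cD uS (fun _ => id)
  (@measurable_cst _ _ _ _ setT 1%E) (fun _ => lee01).
rewrite (integral_cst_probability mu 1) => shiftE.
have {shiftE} e1 : (\int[mu]_z ((expR (- ((t * sigma) ^+ 2 / 2)))%:E *
    (expR (t * design_score e i z))%:E) = 1%:E)%E.
  rewrite shiftE; apply: eq_integral => z _; rewrite mul1e -EFinM; congr EFin.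
  rewrite /S big_map big_enum/= /shift_ratio -expR_sum -expRD; congr expR.
  have -> : (t * sigma) ^+ 2 / 2 = \sum_k (t * sigma) ^+ 2 * e k ^+ 2 / 2.
    by rewrite -mulr_suml -mulr_sumr e_unit mulr1.
  rewrite -sumrN /design_score mulr_sumr -big_split/=; apply: eq_bigr => k _.
  by field; rewrite gt_eqF.
have mE : measurable_fun setT (fun z => (expR (t * design_score e i z))%:E).
  apply/measurable_EFinP; apply: measurableT_comp => //.
  by apply: measurable_funM => //; exact: measurable_design_score.
move: e1; rewrite ge0_integralZl//.
move=> /(congr1 (fun x => (expR ((t * sigma) ^+ 2 / 2))%:E * x)%E).
by rewrite muleA -EFinM -expRD subrr expR0 mul1e mule1.
Qed.

(** Twice the constant of [sqr_le_expR], times the moment generating function of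
    a standard Gaussian at one. *)
Definition score_constant : R := 8 * expR (1 / 2).

(** Bounds a second moment by two exponential moments, which are explicit. *)
Lemma sqr_le_expR (x : R) : x ^+ 2 <= 4 * (expR x + expR (- x)).
Proof.
wlog x0 : x / 0 <= x => [th|].
  have [/th//|x0] := leP 0 x; have := th (- x); rewrite sqrrN opprK addrC.
  by apply; rewrite oppr_ge0 ltW.
have h : 1 + x / 2 <= expR (x / 2) := expR_ge1Dx _.
have -> : expR x = expR (x / 2) ^+ 2 by rewrite expr2 -expRD -splitr.
have := expR_ge0 (- x); nra.
Qed.

Lemma integral_sqr_design_score i :
  (\int[mu]_z (design_score e i z ^+ 2)%:E <= (score_constant * sigma ^+ 2)%:E)%E.
Proof.
have mE t : measurable_fun setT (fun z => (expR (t * design_score e i z))%:E).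
  apply/measurable_EFinP; apply: measurableT_comp => //.
  by apply: measurable_funM => //; exact: measurable_design_score.
have E0 t z : setT z -> (0 <= (expR (t * design_score e i z))%:E)%E.
  by rewrite lee_fin expR_ge0.
apply: (@le_trans _ _ (\int[mu]_z ((4 * sigma ^+ 2)%:E *
    ((expR (sigma^-1 * design_score e i z))%:E +
     (expR (- sigma^-1 * design_score e i z))%:E)))%E).
  apply: ge0_le_integral => //.
  - by move=> z _; rewrite lee_fin sqr_ge0.
  - by apply/measurable_EFinP; apply: measurable_funX; exact: measurable_design_score.
  - by apply: emeasurable_funM => //; exact: emeasurable_funD.
  - move=> z _; rewrite -EFinD -EFinM lee_fin.
    rewrite mulNr; set y := sigma^-1 * _.
    have -> : design_score e i z = sigma * y by rewrite /y; field; rewrite gt_eqF.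
    rewrite exprMn [4 * _]mulrC -[leRHS]mulrA ler_pM2l ?exprn_gt0//.
    exact: sqr_le_expR.
rewrite ge0_integralZl//; last 3 first.
- exact: emeasurable_funD.
- by move=> z _; rewrite adde_ge0// lee_fin expR_ge0.
- by rewrite lee_fin mulr_ge0// sqr_ge0.
rewrite ge0_integralD// !integral_expR_design_score -EFinD -EFinM lee_fin.
rewrite !exprMn sqrrN -!exprMn mulVf ?gt_eqF// expr1n /score_constant.
by rewrite le_eqVlt; apply/orP; left; apply/eqP; ring.
Qed.

Definition noise_shift (tau : R) (z : cube R J) : cube R J :=
  fun j => if j is inl i then z j + tau * design_score e i z else z j.

Definition shift_likelihood (tau : R) (z : cube R J) : R :=
  \prod_(i < n) shift_ratio sigma_xi (z (inl i)) (tau * design_score e i z).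

Lemma measurable_noise_shift tau : measurable_fun setT (noise_shift tau).
Proof.
apply: measurable_to_cube => -[i|ik]; last exact: measurable_coordinate.
apply: measurable_funD; first exact: measurable_coordinate.
by apply: measurable_funM => //; exact: measurable_design_score.
Qed.

Lemma noise_shift_law tau (f : cube R J -> \bar R) :
  measurable_fun setT f -> (forall z, 0 <= f z)%E ->
  (\int[mu]_z f (noise_shift tau z) =
   \int[mu]_z (f z * (shift_likelihood tau z)%:E))%E.
Proof.
move=> mf f0; pose S : seq J := [seq inl i | i <- enum 'I_n].
pose D : pred J := fun j => if j is inl _ then true else false.
pose h (j : J) (z : cube R J) : R :=
  if j is inl i then tau * design_score e i z else 0.
have uS : uniq S by rewrite map_inj_uniq ?enum_uniq// => i i' [].
have mh j : measurable_fun setT (h j).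
  case: j => [i|?]; last exact: measurable_cst.
  by apply: measurable_funM => //; exact: measurable_design_score.
have hD (j : J) (z z' : cube R J) :
    (forall k, ~~ D k -> z k = z' k) -> h j z = h j z'.
  case: j => // i zz'; congr (_ * _).
  by apply: eq_bigr => k _; rewrite (zz' (inr (i, k))).
have SD : {subset S <= D} by move=> j /mapP[i _ ->].
have mem_inl i : (inl i : J) \in S by rewrite mem_map ?mem_enum// => ? ? [].
have mem_inr ik : (inr ik : J) \in S = false by apply/negP => /mapP[].
transitivity (\int[mu]_z f (shift_coords S h z))%E.
  apply: eq_integral => z _; congr f; apply/funext => -[i|ik].
    by rewrite /shift_coords mem_inl.
  by rewrite /shift_coords mem_inr.
rewrite (shift_law muE s_neq0 mh hD uS SD mf f0).
by apply: eq_integral => z _; rewrite /S big_map big_enum.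
Qed.

Definition sqrt_likelihood (tau : R) (z : cube R J) : R :=
  expR (\sum_(i < n) (z (inl i) * (tau * design_score e i z)
                      - (tau * design_score e i z) ^+ 2 / 2)
        / (2 * sigma_xi ^+ 2)).

Lemma measurable_shift_exponent tau i :
  measurable_fun setT (fun z : cube R J => z (inl i) * (tau * design_score e i z)
                      - (tau * design_score e i z) ^+ 2 / 2).
Proof.
have mt : measurable_fun setT (fun z => tau * design_score e i z).
  by apply: measurable_funM => //; exact: measurable_design_score.
apply: measurable_funB.
  by apply: measurable_funM => //; exact: measurable_coordinate.
by apply: measurable_funM => //; exact: measurable_funX.
Qed.

Lemma measurable_sqrt_likelihood tau : measurable_fun setT (sqrt_likelihood tau).
Proof.
apply: measurableT_comp => //; apply: measurable_sum => i.
by apply: measurable_funM => //; exact: measurable_shift_exponent.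
Qed.

Lemma sqr_sqrt_likelihood tau z : sqrt_likelihood tau z ^+ 2 = shift_likelihood tau z.
Proof.
rewrite expr2 -expRD -big_split/= /shift_likelihood /shift_ratio -expR_sum.
by congr expR; apply: eq_bigr => i _; field; rewrite gt_eqF.
Qed.

(** Completing the square writes the root of the likelihood ratio as the
    likelihood ratio of half the shift, times a function of the design alone,
    which the shift law then moves out. *)
Lemma hellinger_affinity tau :
  ((1 - n%:R * (tau ^+ 2 * (score_constant * sigma ^+ 2) / (8 * sigma_xi ^+ 2)))%:E
   <= \int[mu]_z (sqrt_likelihood tau z)%:E)%E.
Proof.
pose v := tau ^+ 2 / (8 * sigma_xi ^+ 2).
have v0 : 0 <= v by rewrite divr_ge0 ?sqr_ge0// mulr_ge0// sqr_ge0.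
pose q (z : cube R J) := \sum_(i < n) design_score e i z ^+ 2.
have mq : measurable_fun setT q.
  by apply: measurable_sum => i; apply: measurable_funX; exact: measurable_design_score.
have q0 z : 0 <= q z by apply: sumr_ge0 => i _; exact: sqr_ge0.
have mf : measurable_fun setT (fun z => (expR (- (v * q z)))%:E).
  apply/measurable_EFinP; apply: measurableT_comp => //.
  by apply: measurableT_comp => //; exact: measurable_funM.
have -> : (\int[mu]_z (sqrt_likelihood tau z)%:E = \int[mu]_z (expR (- (v * q z)))%:E)%E.
  transitivity (\int[mu]_z ((expR (- (v * q z)))%:E
      * (shift_likelihood (tau / 2) z)%:E))%E.
    apply: eq_integral => z _; rewrite /shift_likelihood /shift_ratio -EFinM.
    rewrite -expR_sum -expRD; congr (expR _)%:E.
    rewrite /q mulr_sumr -sumrN -big_split/=; apply: eq_bigr => i _.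
    by rewrite /v; field; rewrite gt_eqF.
  by rewrite -(@noise_shift_law _ (fun z => (expR (- (v * q z)))%:E)).
have qE : (\int[mu]_z (q z)%:E <= (n%:R * (score_constant * sigma ^+ 2))%:E)%E.
  under eq_integral do rewrite -sumEFin.
  rewrite ge0_integral_sum//; last 2 first.
  - move=> i; apply/measurable_EFinP; apply: measurable_funX.
    exact: measurable_design_score.
  - by move=> i z _; rewrite lee_fin sqr_ge0.
  rewrite mulr_natl -[in leRHS](card_ord n) -sumr_const -sumEFin.
  by apply: lee_sum => i _; exact: integral_sqr_design_score.
have vqE : (v%:E * \int[mu]_z (q z)%:E <=
    (n%:R * (tau ^+ 2 * (score_constant * sigma ^+ 2) / (8 * sigma_xi ^+ 2)))%:E)%E.
  apply: (le_trans (lee_wpmul2l _ qE)); first by rewrite lee_fin.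
  rewrite -EFinM lee_fin /v le_eqVlt; apply/orP; left; apply/eqP.
  by field; rewrite gt_eqF.
have le1 : (1%:E <= \int[mu]_z (expR (- (v * q z)))%:E + v%:E * \int[mu]_z (q z)%:E)%E.
  rewrite -(integral_cst_probability mu 1) -ge0_integralZl//; last 2 first.
  - exact/measurable_EFinP.
  - by move=> z _; rewrite lee_fin.
  rewrite -ge0_integralD//; last 2 first.
  - by move=> z _; rewrite mule_ge0// lee_fin.
  - by apply: emeasurable_funM => //; exact/measurable_EFinP.
  apply: ge0_le_integral => //.
    apply: emeasurable_funD => //; apply: emeasurable_funM => //.
    exact/measurable_EFinP.
  move=> z _; rewrite -EFinM -EFinD lee_fin -lerBlDr.
  exact: expR_ge1Dx.
rewrite EFinB leeBlDr//; apply: (le_trans le1).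
by rewrite leeD2l.
Qed.

Lemma total_variation_noise_shift (tau b : R) (E : set (cube R J)) :
  0 < b < 1 ->
  n%:R * (tau ^+ 2 * (score_constant * sigma ^+ 2) / (8 * sigma_xi ^+ 2)) <= b ^+ 2 ->
  measurable E ->
  (mu E <= mu (noise_shift tau @^-1` E) + (3 * b)%:E)%E.
Proof.
move=> b01 tb mE.
have m1 : measurable_fun setT (fun z => (\1_E z : R)%:E).
  by apply/measurable_EFinP; exact: measurable_indic.
have mS : measurable (noise_shift tau @^-1` E).
  by rewrite -[X in measurable X]setTI; exact: measurable_noise_shift.
have -> : (mu (noise_shift tau @^-1` E) =
    \int[mu]_z ((\1_E z)%:E * (sqrt_likelihood tau z ^+ 2)%:E))%E.
  under [RHS]eq_integral do rewrite sqr_sqrt_likelihood.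
  rewrite -(@noise_shift_law tau (fun z => (\1_E z)%:E))//.
  by rewrite -[X in mu X]setIT -(@integral_indic _ _ _ mu _ measurableT _ mS).
apply: le_of_hellinger_affinity => //.
- exact: measurable_sqrt_likelihood.
- by move=> z; exact: expR_ge0.
- under eq_integral do rewrite sqr_sqrt_likelihood -[(shift_likelihood _ _)%:E]mul1e.
  rewrite -(@noise_shift_law tau (cst 1%E))//.
  exact: integral_cst_probability.
- apply: le_trans (hellinger_affinity tau); rewrite lee_fin lerD2l lerN2.
  exact: tb.
Qed.

End RegressionShift.

(** * The regression model *)

Section RegressionModel.
Context {R : realType} {p1 p2 p3 n : nat}.
Local Notation K := ('I_p1 * 'I_p2 * 'I_p3)%type.
Local Notation J := ('I_n + 'I_n * K)%type.
Local Notation data := (n.-tuple (R * tensor R p1 p2 p3))%type.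

Lemma measurable_entry (k : K) :
  measurable_fun setT (fun T : tensor R p1 p2 p3 => T k).
Proof.
move=> _ B mB; rewrite setTI.
by apply: sub_sigma_algebra; exists k, B.
Qed.

Lemma measurable_to_tensor d (T : measurableType d) (f : T -> tensor R p1 p2 p3) :
  (forall k, measurable_fun setT (fun t => f t k)) -> measurable_fun setT f.
Proof.
move=> mf; apply: (@measurability _ _ _ _ _ _ (@entry_cylinders R p1 p2 p3)) => //.
by move=> _ [_ [k [B [mB ->]] <-]]; exact: mf.
Qed.

Definition design (i : 'I_n) (z : cube R J) : tensor R p1 p2 p3 :=
  [ffun k => z (inr (i, k))].

Definition data_of (T : tensor R p1 p2 p3) (z : cube R J) : data :=
  [tuple (tdot T (design i z) + z (inl i), design i z) | i < n].

Lemma measurable_data_of T : measurable_fun setT (data_of T).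
Proof.
have mD i : measurable_fun setT (design i).
  apply: measurable_to_tensor => k.
  rewrite [X in measurable_fun _ X](_ : _ = fun z : cube R J => z (inr (i, k))).
    exact: measurable_coordinate.
  by apply/funext => z; rewrite ffunE.
apply/measurable_fun_tnthP => i.
rewrite [X in measurable_fun _ X](_ : _ =
    fun z => (tdot T (design i z) + z (inl i), design i z)); last first.
  by apply/funext => z; rewrite /= tnth_mktuple.
apply: measurable_fun_pair => //.
apply: measurable_funD; last exact: measurable_coordinate.
apply: measurable_sum => k; apply: measurable_funM => //.
exact: (measurableT_comp (measurable_entry k) (mD i)).
Qed.

(** The signal enters the data through the responses only, and linearly. *)
Lemma data_of_shift (T0 T1 e : tensor R p1 p2 p3) (tau : R) (z : cube R J) :
  (forall k, T1 k = T0 k + tau * e k) ->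
  data_of T1 z = data_of T0 (noise_shift (fun k => e k) tau z).
Proof.
move=> T1E; have dE i : design i (noise_shift (fun k => e k) tau z) = design i z.
  by apply/ffunP => k; rewrite !ffunE.
apply: eq_from_tnth => i; rewrite !tnth_mktuple dE; congr (_, _).
rewrite /= [z (inl i) + _]addrC addrA; congr (_ + _).
rewrite /tdot /design_score mulr_sumr -big_split/=; apply: eq_bigr => k _.
by rewrite T1E ffunE mulrDl mulrA.
Qed.

Context {d : measure_display} {Omega : measurableType d}.
Variable P : probability Omega R.
Variables (X : 'I_n -> {RV P >-> tensor R p1 p2 p3}) (xi : 'I_n -> {RV P >-> R}).

Definition noise_design (w : Omega) : cube R J :=
  fun j => match j with inl i => xi i w | inr (i, k) => X i w k end.

Lemma measurable_noise_design : measurable_fun setT noise_design.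
Proof.
apply: measurable_to_cube => -[i|[i k]] /=; first exact: measurable_funPT.
exact: (measurableT_comp (measurable_entry k) (measurable_funPT (X i))).
Qed.

Lemma data_of_noise_design T w : data_of T (noise_design w) = regression_data X xi T w.
Proof.
apply: eq_from_tnth => i; rewrite !tnth_mktuple.
have -> : design i (noise_design w) = X i w by apply/ffunP => k; rewrite ffunE.
by [].
Qed.

Lemma measurable_regression_data T : measurable_fun setT (regression_data X xi T).
Proof.
rewrite [X in measurable_fun _ X](_ : _ = data_of T \o noise_design).
  exact: (measurableT_comp (measurable_data_of T) measurable_noise_design).
by apply/funext => w; rewrite /= data_of_noise_design.
Qed.

Variables (sigma sigma_xi : R).
Hypotheses (sigma_xi_gt0 : 0 < sigma_xi) (sigma_gt0 : 0 < sigma).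
Hypothesis model : gaussian_design_noise X xi sigma sigma_xi.

(** Under [P] the noise and design entries form a Gaussian product measure, and
    the two data laws are images of it by the same map, with and without a shift
    of the noise. *)
Lemma total_variation_regression (T0 T1 e : tensor R p1 p2 p3) (tau b : R)
    (B : set data) :
  \sum_k e k ^+ 2 = 1 -> (forall k, T1 k = T0 k + tau * e k) -> 0 < b < 1 ->
  n%:R * (tau ^+ 2 * (score_constant * sigma ^+ 2) / (8 * sigma_xi ^+ 2)) <= b ^+ 2 ->
  measurable B ->
  (P (regression_data X xi T0 @^-1` B) <=
   P (regression_data X xi T1 @^-1` B) + (3 * b)%:E)%E.
Proof.
move=> e1 T1E b01 tb mB; have mZ := measurable_noise_design.
pose Z : {mfun Omega >-> cube R J} := HB.pack noise_design
  (isMeasurableFun.Build _ _ _ _ noise_design mZ).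
pose mu : probability (cube R J) R := distribution P Z.
have muE A : mu A = P (noise_design @^-1` A) by [].
have gauss : product_gaussian (noise_or_design sigma_xi sigma) mu.
  move=> C mC; case: model => mxi mX ind; rewrite muE.
  have := ind [set: J]%SET C mC.
  rewrite (_ : \bigcap_(j in _) _ = noise_design @^-1` box C); last first.
    apply/seteqP; split => w /= h; last first.
      by move=> [i|[i k]] _; exact: h.
    move=> j; have := h j; rewrite /= inE => /(_ isT).
    by case: j => [i|[i k]].
  move=> ->; congr EFin; apply: eq_big => [j|j _]; first by rewrite inE.
  by case: j => [i|[i k]]; congr fine; [exact: mxi|exact: mX].
have dE T : regression_data X xi T @^-1` B = noise_design @^-1` (data_of T @^-1` B).
  by apply/seteqP; split => w /=; rewrite data_of_noise_design.
rewrite !dE -!muE.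
have -> : data_of T1 @^-1` B = noise_shift (fun k => e k) tau @^-1` (data_of T0 @^-1` B).
  by apply/seteqP; split => z /=; rewrite (data_of_shift _ T1E).
apply: (total_variation_noise_shift sigma_xi_gt0 sigma_gt0 gauss) => //.
by rewrite -[X in measurable X]setTI; exact: measurable_data_of.
Qed.

End RegressionModel.

(** * The two-point bound *)

Section TwoPoint.
Context {R : realType} {p1 p2 p3 n : nat}.
Local Notation data := (n.-tuple (R * tensor R p1 p2 p3))%type.
Context {d : measure_display} {Omega : measurableType d}.
Variable P : probability Omega R.
Variables (X : 'I_n -> {RV P >-> tensor R p1 p2 p3}) (xi : 'I_n -> {RV P >-> R}).

Definition covers (CI : @interval_estimator R p1 p2 p3 n) (x : R) : set data :=
  [set D | lower CI D <= x <= upper CI D].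

Lemma measurable_covers CI x : measurable (covers CI x).
Proof.
rewrite (_ : covers CI x = lower CI @^-1` `]-oo, x] `&` upper CI @^-1` `[x, +oo[).
  by apply: measurableI; rewrite -[X in measurable X]setTI; exact: measurable_funPT.
by apply/seteqP; split => D /=; rewrite /covers/= !in_itv/= ?andbT; move/andP.
Qed.

Lemma coverage_ge alpha Th A CI T :
  valid_cis X xi alpha Th A CI -> Th T ->
  ((1 - alpha)%:E <= P (regression_data X xi T @^-1` covers CI (tdot T A)))%E.
Proof.
move=> v ThT; apply: (le_trans v); apply: ereal_inf_lbound.
by exists T.
Qed.

(** Le Cam's two-point bound: an interval that covers the functional under both
    signals must, under [T0], contain both values on an event whose probability
    the total variation controls. *)
Lemma two_point_expected_length (alpha tv : R) Th (A T0 T1 : tensor R p1 p2 p3) CI :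
  valid_cis X xi alpha Th A CI -> Th T0 -> Th T1 ->
  (forall B, measurable B ->
     (P (regression_data X xi T0 @^-1` B) <=
      P (regression_data X xi T1 @^-1` B) + tv%:E)%E) ->
  ((`|tdot T1 A - tdot T0 A| * (1 - 2 * alpha - tv))%:E
   <= expected_length X xi CI T0)%E.
Proof.
move=> v Th0 Th1 TV; set f0 := tdot T0 A; set f1 := tdot T1 A.
pose D0 := regression_data X xi T0; pose D1 := regression_data X xi T1.
have mD0 : measurable_fun setT D0 by exact: measurable_regression_data.
have mD1 : measurable_fun setT D1 by exact: measurable_regression_data.
have mpre (f : Omega -> data) B : measurable_fun setT f -> measurable B ->
    measurable (f @^-1` B).
  by move=> mf mB; rewrite -[X in measurable X]setTI; exact: mf.
have mc0 := measurable_covers CI f0; have mc1 := measurable_covers CI f1.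
pose G := D0 @^-1` (covers CI f0 `&` covers CI f1).
have mG : measurable G by apply: mpre => //; exact: measurableI.
have mH : measurable (D0 @^-1` (~` covers CI f1)).
  exact: (mpre _ _ mD0 (measurableC mc1)).
have miss : (P (D0 @^-1` (~` covers CI f1)) <= (alpha + tv)%:E)%E.
  apply: (le_trans (TV _ (measurableC mc1))).
  have mC1 := mpre _ _ mD1 mc1.
  rewrite EFinD leeD2r// preimage_setC probability_setC//.
  rewrite leeBlDr ?fin_num_measure// -leeBlDl// -EFinB.
  exact: coverage_ge v Th1.
have hit : ((1 - 2 * alpha - tv)%:E <= P G)%E.
  have : ((1 - alpha)%:E <= P G + (alpha + tv)%:E)%E.
    apply: (le_trans (coverage_ge v Th0)).
    apply: (@le_trans _ _ (P G + P (D0 @^-1` (~` covers CI f1)))%E); last exact: leeD2l.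
    apply: le_trans (measureU2 P mG mH).
    apply: le_measure; rewrite ?inE//; first exact: (mpre _ _ mD0 mc0).
      exact: measurableU.
    by move=> w /= c0; rewrite /G/=; case: (pselect (covers CI f1 (D0 w))) => ?; [left|right].
  rewrite -leeBlDr// -EFinB; apply: le_trans; rewrite lee_fin; lra.
have m1 : measurable_fun setT (fun w => (\1_G w : R)%:E).
  by apply/measurable_EFinP; exact: measurable_indic.
apply: (@le_trans _ _ (`|f1 - f0|%:E * P G)%E).
  by rewrite EFinM lee_wpmul2l// lee_fin.
have -> : P G = (\int[P]_w (\1_G w)%:E)%E by rewrite integral_indic// setIT.
rewrite -ge0_integralZl//.
rewrite /expected_length unlock; apply: ge0_le_integral => //.
- exact: emeasurable_funM.
- apply/measurable_EFinP; apply: measurable_funB.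
    exact: (measurableT_comp (measurable_funPT (upper CI)) mD0).
  exact: (measurableT_comp (measurable_funPT (lower CI)) mD0).
move=> w _; rewrite -EFinM lee_fin /ci_length indicE.
case: (boolP (w \in G)) => [|_]; last by rewrite mulr0 subr_ge0 lower_le_upper.
rewrite inE /G /= /covers /= => -[/andP[a1 a2] /andP[b1 b2]].
rewrite mulr1 ler_norml; apply/andP; split; lra.
Qed.

End TwoPoint.

(** * Rank-one tensors *)

Section RankOneTensor.
Context {R : realType}.

Definition rank_one p1 p2 p3 (s : R) (x : 'cV[R]_p1) (y : 'cV[R]_p2) (z : 'cV[R]_p3) :
  tensor R p1 p2 p3 := [ffun k => s * (x k.1.1 0 * y k.1.2 0 * z k.2 0)].

Definition unit_vector p (x : 'cV[R]_p) : Prop := \sum_a x a 0 ^+ 2 = 1.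

Lemma sum_triple (I J K : finType) (F : I * J * K -> R) :
  \sum_l F l = \sum_i \sum_j \sum_k F (i, j, k).
Proof.
rewrite pair_bigA /= pair_bigA /=.
by apply: eq_bigr => -[[i j] k] _.
Qed.

Lemma sum_mxtens m n (F : 'I_m -> 'I_n -> R) :
  \sum_(c < m * n) F (mxtens_unindex c).1 (mxtens_unindex c).2 = \sum_i \sum_j F i j.
Proof.
rewrite pair_bigA /= [RHS](reindex (@mxtens_unindex m n))//=.
by exists (@mxtens_index m n) => i _; rewrite (mxtens_indexK, mxtens_unindexK).
Qed.

Lemma tdot_rank_one p1 p2 p3 s x y z (A : tensor R p1 p2 p3) :
  tdot (rank_one s x y z) A =
  s * \sum_a \sum_b \sum_c x a 0 * y b 0 * z c 0 * A (a, b, c).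
Proof.
rewrite /tdot sum_triple mulr_sumr; apply: eq_bigr => a _.
rewrite mulr_sumr; apply: eq_bigr => b _; rewrite mulr_sumr; apply: eq_bigr => c _.
by rewrite ffunE /= !mulrA.
Qed.

Lemma tdot_rank_one_scale p1 p2 p3 s x y z (A : tensor R p1 p2 p3) :
  tdot (rank_one s x y z) A = s * tdot (rank_one 1 x y z) A.
Proof. by rewrite !tdot_rank_one mul1r. Qed.

Lemma rank_one_unit p1 p2 p3 (x : 'cV[R]_p1) (y : 'cV[R]_p2) (z : 'cV[R]_p3) :
  unit_vector x -> unit_vector y -> unit_vector z ->
  \sum_k rank_one 1 x y z k ^+ 2 = 1.
Proof.
rewrite /unit_vector => x1 y1 z1; rewrite sum_triple.
transitivity ((\sum_a x a 0 ^+ 2) * ((\sum_b y b 0 ^+ 2) * \sum_c z c 0 ^+ 2)).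
  rewrite mulr_suml; apply: eq_bigr => a _.
  rewrite mulr_suml mulr_sumr; apply: eq_bigr => b _.
  rewrite !mulr_sumr; apply: eq_bigr => c _.
  by rewrite ffunE /= mul1r !exprMn mulrA.
by rewrite x1 y1 z1 !mulr1.
Qed.

(** If [v] is an eigenvector of [s ^+ 2 *: x *m x^T] for a nonzero eigenvalue, it
    is not orthogonal to [x]; pairing the eigenvalue equation with [x] then gives
    the eigenvalue. *)
Lemma singular_value_rank_one m n (M : 'M[R]_(m, n)) (s t : R) (x : 'cV[R]_m) :
  0 < s -> unit_vector x -> (forall a b, (M *m M^T) a b = s ^+ 2 * (x a 0 * x b 0)) ->
  nonzero_singular_value M t -> t = s.
Proof.
move=> s0 x1 ME [t0 /eigenvalueP[v vE v0]].
have xx : x^T *m x = 1%:M.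
  apply/matrixP => i j; rewrite !ord1 !mxE eqxx -[RHS]x1.
  by apply: eq_bigr => a _; rewrite mxE expr2.
have {}ME : M *m M^T = s ^+ 2 *: (x *m x^T).
  by apply/matrixP => a b; rewrite ME !mxE big_ord1 !mxE.
move: vE; rewrite ME -scalemxAr mulmxA => vE.
have := congr1 (mulmx^~ x) vE; rewrite /= -!scalemxAl.
have -> : v *m x *m x^T *m x = v *m x by rewrite -mulmxA xx mulmx1.
move=> /eqP; rewrite -subr_eq0 -scalerBl scaler_eq0 => /orP[|/eqP vx].
  rewrite subr_eq0 => /eqP e; apply/eqP.
  by rewrite -(eqrXn2 (n := 2))// ?ltW// e.
move: vE; rewrite vx mul0mx scaler0 => /esym/eqP; rewrite scaler_eq0 (negbTE v0).
by rewrite orbF expf_eq0 gt_eqF.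
Qed.

Lemma gram_mat1_rank_one p1 p2 p3 s (x : 'cV[R]_p1) (y : 'cV[R]_p2) (z : 'cV[R]_p3) a b :
  unit_vector y -> unit_vector z ->
  (mat1 (rank_one s x y z) *m (mat1 (rank_one s x y z))^T) a b =
  s ^+ 2 * (x a 0 * x b 0).
Proof.
rewrite /unit_vector => y1 z1; rewrite mxE.
under eq_bigr do rewrite !mxE !ffunE /=.
rewrite (sum_mxtens (fun c b' => s * (x a 0 * y b' 0 * z c 0) * (s * (x b 0 * y b' 0 * z c 0)))).
rewrite -[RHS]mulr1 -z1 mulr_sumr; apply: eq_bigr => c _.
rewrite -[RHS]mulr1 -y1 mulr_sumr; apply: eq_bigr => b' _.
by ring.
Qed.

Lemma gram_mat2_rank_one p1 p2 p3 s (x : 'cV[R]_p1) (y : 'cV[R]_p2) (z : 'cV[R]_p3) a b :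
  unit_vector x -> unit_vector z ->
  (mat2 (rank_one s x y z) *m (mat2 (rank_one s x y z))^T) a b =
  s ^+ 2 * (y a 0 * y b 0).
Proof.
rewrite /unit_vector => x1 z1; rewrite mxE.
under eq_bigr do rewrite !mxE !ffunE /=.
rewrite (sum_mxtens (fun c b' => s * (x c 0 * y a 0 * z b' 0) * (s * (x c 0 * y b 0 * z b' 0)))).
rewrite -[RHS]mulr1 -x1 mulr_sumr; apply: eq_bigr => c _.
rewrite -[RHS]mulr1 -z1 mulr_sumr; apply: eq_bigr => b' _.
by ring.
Qed.

Lemma gram_mat3_rank_one p1 p2 p3 s (x : 'cV[R]_p1) (y : 'cV[R]_p2) (z : 'cV[R]_p3) a b :
  unit_vector x -> unit_vector y ->
  (mat3 (rank_one s x y z) *m (mat3 (rank_one s x y z))^T) a b =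
  s ^+ 2 * (z a 0 * z b 0).
Proof.
rewrite /unit_vector => x1 y1; rewrite mxE.
under eq_bigr do rewrite !mxE !ffunE /=.
rewrite (sum_mxtens (fun c b' => s * (x b' 0 * y c 0 * z a 0) * (s * (x b' 0 * y c 0 * z b 0)))).
rewrite -[RHS]mulr1 -y1 mulr_sumr; apply: eq_bigr => c _.
rewrite -[RHS]mulr1 -x1 mulr_sumr; apply: eq_bigr => b' _.
by ring.
Qed.

Lemma orthonormal_unit p r (U : 'M[R]_(p, r)) i :
  orthonormal_cols U -> unit_vector (col i U).
Proof.
move=> /matrixP/(_ i i); rewrite !mxE eqxx; apply: etrans.
by apply: eq_bigr => a _; rewrite !mxE expr2.
Qed.

Lemma tucker_single_entry p1 p2 p3 r1 r2 r3 s (U1 : 'M[R]_(p1, r1))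
    (U2 : 'M[R]_(p2, r2)) (U3 : 'M[R]_(p3, r3)) i j k :
  tucker [ffun l => if l == (i, j, k) then s else 0] U1 U2 U3 =
  rank_one s (col i U1) (col j U2) (col k U3).
Proof.
apply/ffunP => -[[a b] c]; rewrite !ffunE /= (bigD1 k)//= big1 => [|k' kk]; last first.
  rewrite ffunE /= big1 ?mulr0// => j' _; rewrite ffunE big1 ?mulr0// => i' _.
  by rewrite ffunE !xpair_eqE (negbTE kk) andbF mulr0.
rewrite ffunE /= (bigD1 j)//= big1 => [|j' jj]; last first.
  rewrite ffunE big1 ?mulr0// => i' _.
  by rewrite ffunE !xpair_eqE (negbTE jj) andbF mulr0.
rewrite ffunE /= (bigD1 i)//= big1 => [|i' ii]; last first.
  by rewrite ffunE !xpair_eqE (negbTE ii) mulr0.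
by rewrite ffunE eqxx !mxE !addr0; ring.
Qed.

(** Every matricization of a rank-one tensor has [s] as its only nonzero singular
    value, and zero singular values are unconstrained. *)
Lemma rank_one_Theta p1 p2 p3 r1 r2 r3 lam kappa s (U1 : 'M[R]_(p1, r1))
    (U2 : 'M[R]_(p2, r2)) (U3 : 'M[R]_(p3, r3)) i j k :
  orthonormal_cols U1 -> orthonormal_cols U2 -> orthonormal_cols U3 ->
  0 < s -> lam <= s <= kappa * lam ->
  Theta r1 r2 r3 lam kappa (rank_one s (col i U1) (col j U2) (col k U3)).
Proof.
move=> o1 o2 o3 s0 sl; split.
  by do 4 eexists; split; last by symmetry; apply: tucker_single_entry.
have u1 := orthonormal_unit i o1; have u2 := orthonormal_unit j o2.
have u3 := orthonormal_unit k o3.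
move=> t [|[|]] h.
- rewrite (singular_value_rank_one s0 u1 _ h)// => a b; exact: gram_mat1_rank_one.
- rewrite (singular_value_rank_one s0 u2 _ h)// => a b; exact: gram_mat2_rank_one.
- rewrite (singular_value_rank_one s0 u3 _ h)// => a b; exact: gram_mat3_rank_one.
Qed.

Lemma tucker_entry p1 p2 p3 r1 r2 r3 (A : tensor R p1 p2 p3) (U1 : 'M[R]_(p1, r1))
    (U2 : 'M[R]_(p2, r2)) (U3 : 'M[R]_(p3, r3)) i j k :
  tucker A U1^T U2^T U3^T (i, j, k) =
  tdot (rank_one 1 (col i U1) (col j U2) (col k U3)) A.
Proof.
rewrite tdot_rank_one mul1r exchange_big /=.
under eq_bigr do rewrite exchange_big /=.
rewrite exchange_big /= ffunE /=; apply: eq_bigr => c _; rewrite ffunE mulr_sumr /=.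
apply: eq_bigr => b _; rewrite ffunE /= !mulr_sumr; apply: eq_bigr => a _.
by rewrite !mxE; ring.
Qed.

End RankOneTensor.

(** * The tangent norm and rank-one pairings *)

Section TangentNorm.
Context {R : realType}.

Lemma mxnormF_trace m n (M : 'M[R]_(m, n)) : mxnormF M ^+ 2 = \tr (M *m M^T).
Proof.
rewrite sqr_sqrtr; last by apply: sumr_ge0 => i _; apply: sumr_ge0 => j _; exact: sqr_ge0.
apply: eq_bigr => i _; rewrite !mxE; apply: eq_bigr => j _.
by rewrite !mxE expr2.
Qed.

(** Pythagoras for [M *m P] and [M *m (1 - P)]. *)
Lemma mxnormF_projection m n (M : 'M[R]_(m, n)) (P : 'M[R]_n) :
  P^T = P -> P *m P = P -> mxnormF (M *m P) ^+ 2 <= mxnormF M ^+ 2.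
Proof.
move=> PT PP.
have e Q : Q^T = Q -> Q *m Q = Q -> mxnormF (M *m Q) ^+ 2 = \tr (M *m Q *m M^T).
  by move=> QT QQ; rewrite mxnormF_trace trmx_mul QT mulmxA -(mulmxA M) QQ.
have CT : (1%:M - P)^T = 1%:M - P by rewrite linearB /= trmx1 PT.
have CC : (1%:M - P) *m (1%:M - P) = 1%:M - P.
  by rewrite mulmxBl mul1mx mulmxBr mulmx1 PP subrr subr0.
rewrite [leRHS]mxnormF_trace -subr_ge0 e//.
have -> : \tr (M *m M^T) - \tr (M *m P *m M^T) = mxnormF (M *m (1%:M - P)) ^+ 2.
  by rewrite e// mulmxBr mulmx1 mulmxBl linearB.
exact: sqr_ge0.
Qed.

Lemma mxnormF_columns m n (M : 'M[R]_(m, n)) :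
  mxnormF M ^+ 2 = \sum_j \sum_i M i j ^+ 2.
Proof.
rewrite sqr_sqrtr; last by apply: sumr_ge0 => i _; apply: sumr_ge0 => j _; exact: sqr_ge0.
exact: exchange_big.
Qed.

Definition replace_column p r (U : 'M[R]_(p, r)) (i : 'I_r) (v : 'cV[R]_p) :
  'M[R]_(p, r) := \matrix_(a, j) if j == i then v a 0 else U a j.

Lemma replace_column_col p r (U : 'M[R]_(p, r)) i v : col i (replace_column U i v) = v.
Proof. by apply/matrixP => a b; rewrite !mxE eqxx ord1. Qed.

Lemma replace_column_orthonormal p r (U : 'M[R]_(p, r)) i (v : 'cV[R]_p) :
  orthonormal_cols U -> U^T *m v = 0 -> unit_vector v ->
  orthonormal_cols (replace_column U i v).
Proof.
move=> oU Uv v1; apply/matrixP => j k; rewrite !mxE.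
have UvE l : \sum_a U a l * v a 0 = 0.
  have /matrixP/(_ l 0) := Uv; rewrite !mxE; apply: etrans.
  by apply: eq_bigr => a _; rewrite !mxE.
have [->|ji] := eqVneq j i; have [->|ki] := eqVneq k i.
- apply: etrans v1; apply: eq_bigr => a _.
  by rewrite !mxE eqxx expr2.
- rewrite -[RHS](UvE k); apply: eq_bigr => a _.
  by rewrite !mxE eqxx (negbTE ki) mulrC.
- rewrite (negbTE ji) -[RHS](UvE j); apply: eq_bigr => a _.
  by rewrite !mxE eqxx (negbTE ji).
- have /matrixP/(_ j k) := oU; rewrite !mxE => <-; apply: eq_bigr => a _.
  by rewrite !mxE (negbTE ji) (negbTE ki).
Qed.

Lemma tensmx_orthonormal q2 s2 q1 s1 (V : 'M[R]_(q2, s2)) (W : 'M[R]_(q1, s1)) :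
  orthonormal_cols V -> orthonormal_cols W -> orthonormal_cols (tensmx V W).
Proof.
move=> oV oW; apply/matrixP => c c'.
case: (mxtens_indexP c) => i j; case: (mxtens_indexP c') => i' j'.
have /matrixP/(_ i i') := oV; have /matrixP/(_ j j') := oW; rewrite !mxE => Wj Vi.
rewrite (can_eq (@mxtens_indexK _ _)) xpair_eqE -mulnb natrM -Vi -Wj mulr_sum.
apply: eq_bigr => l _; case: (mxtens_indexP l) => a b.
by rewrite mxtens_indexK !mxE !mxtens_indexK /=; ring.
Qed.

(** The projection onto the column space of [tensmx V W *m Gj^T] factors through
    the columns of [tensmx V W], so dropping it bounds the component by
    [N = C *m Aj *m tensmx V W]. A nonzero column of [N] is orthogonal to [U], and
    its norm is its pairing, once normalized, with the same column of
    [Aj *m tensmx V W]. The index [i] in the hypothesis records that [U] has a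
    column; without columns in [U] the core, hence the component, is zero. *)
Lemma mode_component_le p r q2 s2 q1 s1 (U : 'M[R]_(p, r)) (V : 'M[R]_(q2, s2))
    (W : 'M[R]_(q1, s1)) (Aj : 'M[R]_(p, q2 * q1)) (Gj : 'M[R]_(r, s2 * s1)) (m : R) :
  orthonormal_cols U -> orthonormal_cols V -> orthonormal_cols W -> 0 <= m ->
  (forall (i : 'I_r) (v : 'cV[R]_p), U^T *m v = 0 -> unit_vector v ->
     forall c, `|(v^T *m Aj *m tensmx V W) 0 c| <= m) ->
  mxnormF (mode_component U V W Aj Gj) ^+ 2 <= (s2 * s1)%:R * m ^+ 2.
Proof.
move=> oU oV oW m0 H; rewrite /mode_component; set Q := tensmx V W.
have := orth_projP (Q *m Gj^T); set C := orth_compl_proj U.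
move: (orth_proj (Q *m Gj^T)) => P [PT PP _ Psub].
have rhs0 : 0 <= (s2 * s1)%:R * m ^+ 2 by rewrite mulr_ge0// sqr_ge0.
case: (posnP r) => [r0|r_gt0].
  have P0 : P = 0.
    move: Psub; rewrite PT trmx_mul trmxK => /submxP[D ->].
    have -> : Gj = 0 by move: (Gj); rewrite r0 => Gj'; exact: flatmx0.
    by rewrite mul0mx mulmx0.
  by rewrite P0 mulmx0 mxnormF_trace mul0mx mxtrace0.
have oQ : Q^T *m Q = 1%:M by exact: tensmx_orthonormal.
have PQ : P = Q *m Q^T *m P.
  have PQQ : P *m Q *m Q^T = P.
    move: Psub; rewrite PT trmx_mul trmxK => /submxP[D ->].
    by rewrite -!mulmxA (mulmxA Q^T) oQ mul1mx.
  by have := congr1 trmx PQQ; rewrite !trmx_mul trmxK PT mulmxA => ->.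
pose N := C *m Aj *m Q.
have -> : C *m Aj *m P = N *m Q^T *m P by rewrite {1}PQ /N !mulmxA.
apply: (le_trans (mxnormF_projection _ PT PP)).
have -> : mxnormF (N *m Q^T) ^+ 2 = mxnormF N ^+ 2.
  by rewrite !mxnormF_trace trmx_mul trmxK mulmxA -(mulmxA N) oQ mulmx1.
rewrite mxnormF_columns mulr_natl -[X in _ *+ X]card_ord -sumr_const.
apply: ler_sum => c _; set nu2 := \sum_i N i c ^+ 2.
have nu2_ge0 : 0 <= nu2 by apply: sumr_ge0 => i _; exact: sqr_ge0.
have [->|nu2_neq0] := eqVneq nu2 0; first exact: sqr_ge0.
pose nu := Num.sqrt nu2.
have nuE : nu ^+ 2 = nu2 by rewrite sqr_sqrtr.
have nu_gt0 : 0 < nu by rewrite sqrtr_gt0 lt0r nu2_neq0.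
pose v : 'cV[R]_p := nu^-1 *: col c N.
have vE a : v a 0 = nu^-1 * N a c by rewrite mxE [X in _ * X]mxE.
have UC : U^T *m C = 0.
  by rewrite /C /orth_compl_proj mulmxBr mulmx1 mulmxA oU mul1mx subrr.
have CT : C^T = C by rewrite /C /orth_compl_proj linearB /= trmx1 trmx_mul trmxK.
have Uv : U^T *m v = 0.
  by rewrite /v -scalemxAr colE /N !mulmxA UC !mul0mx scaler0.
have v1 : unit_vector v.
  rewrite /unit_vector; under eq_bigr do rewrite vE exprMn.
  by rewrite -mulr_sumr -/nu2 -nuE exprVn mulVf// expf_neq0// gt_eqF.
have vC : v^T *m C = v^T.
  rewrite /C /orth_compl_proj mulmxBr mulmx1 mulmxA.
  by rewrite -[v^T *m U]trmxK trmx_mul trmxK Uv trmx0 mul0mx subr0.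
have vN : (v^T *m Aj *m Q) 0 c = nu.
  rewrite -[in LHS]vC -2!mulmxA (mulmxA C) -/N mxE.
  transitivity (nu^-1 * nu2); last by rewrite -nuE expr2 mulrA mulVf ?mul1r// gt_eqF.
  rewrite mulr_sumr; apply: eq_bigr => i _.
  by rewrite [v^T 0 i]mxE vE -mulrA expr2.
have := H (Ordinal r_gt0) v Uv v1 c; rewrite vN gtr0_norm// -nuE => h.
by rewrite ler_sqr// nnegrE// ltW.
Qed.

(** The root counts the pairings: the columns in each of the three mode
    components and the entries of the core. Adding one makes it positive even
    when all ranks vanish. *)
Definition tangent_constant (r1 r2 r3 : nat) : R :=
  Num.sqrt (r3 * r2 + r1 * r3 + r2 * r1 + r1 * r2 * r3)%:R + 1.

(** For a mode component, the unit vector orthogonal to the frame replaces one of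
    its columns, which keeps the frame orthonormal. *)
Lemma tangent_norm_le p1 p2 p3 r1 r2 r3 (G : tensor R r1 r2 r3)
    (U1 : 'M[R]_(p1, r1)) (U2 : 'M[R]_(p2, r2)) (U3 : 'M[R]_(p3, r3))
    (A : tensor R p1 p2 p3) (m : R) :
  orthonormal_cols U1 -> orthonormal_cols U2 -> orthonormal_cols U3 -> 0 <= m ->
  (forall (V1 : 'M[R]_(p1, r1)) (V2 : 'M[R]_(p2, r2)) (V3 : 'M[R]_(p3, r3)) i j k,
     orthonormal_cols V1 -> orthonormal_cols V2 -> orthonormal_cols V3 ->
     `|tdot (rank_one 1 (col i V1) (col j V2) (col k V3)) A| <= m) ->
  tangent_norm G U1 U2 U3 A <= tangent_constant r1 r2 r3 * m.
Proof.
move=> o1 o2 o3 m0 H.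
have M1 : mxnormF (mode_component U1 U3 U2 (mat1 A) (mat1 G)) ^+ 2
    <= (r3 * r2)%:R * m ^+ 2.
  apply: mode_component_le => // i v Uv v1 c; case: (mxtens_indexP c) => k j.
  have := H _ _ _ i j k (replace_column_orthonormal i o1 Uv v1) o2 o3.
  rewrite replace_column_col tdot_rank_one mul1r.
  suff -> : \sum_a \sum_b \sum_c0 v a 0 * col j U2 b 0 * col k U3 c0 0 * A (a, b, c0) =
    (v^T *m mat1 A *m tensmx U3 U2) 0 (mxtens_index (k, j)) by [].
  rewrite -mulmxA mxE; apply: eq_bigr => a _; rewrite !mxE mulr_sumr exchange_big /=.
  rewrite -(sum_mxtens (fun c' b' => v a 0 * col j U2 b' 0 * col k U3 c' 0 * A (a, b', c'))).
  by apply: eq_bigr => l _; rewrite !mxE mxtens_indexK /=; ring.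
have M2 : mxnormF (mode_component U2 U1 U3 (mat2 A) (mat2 G)) ^+ 2
    <= (r1 * r3)%:R * m ^+ 2.
  apply: mode_component_le => // j v Uv v1 c; case: (mxtens_indexP c) => i k.
  have := H _ _ _ i j k o1 (replace_column_orthonormal j o2 Uv v1) o3.
  rewrite replace_column_col tdot_rank_one mul1r.
  suff -> : \sum_a \sum_b \sum_c0 col i U1 a 0 * v b 0 * col k U3 c0 0 * A (a, b, c0) =
    (v^T *m mat2 A *m tensmx U1 U3) 0 (mxtens_index (i, k)) by [].
  rewrite exchange_big /=.
  rewrite -mulmxA mxE; apply: eq_bigr => b _; rewrite !mxE mulr_sumr.
  rewrite -(sum_mxtens (fun a' c' => col i U1 a' 0 * v b 0 * col k U3 c' 0 * A (a', b, c'))).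
  by apply: eq_bigr => l _; rewrite !mxE mxtens_indexK /=; ring.
have M3 : mxnormF (mode_component U3 U2 U1 (mat3 A) (mat3 G)) ^+ 2
    <= (r2 * r1)%:R * m ^+ 2.
  apply: mode_component_le => // k v Uv v1 c; case: (mxtens_indexP c) => j i.
  have := H _ _ _ i j k o1 o2 (replace_column_orthonormal k o3 Uv v1).
  rewrite replace_column_col tdot_rank_one mul1r.
  suff -> : \sum_a \sum_b \sum_c0 col i U1 a 0 * col j U2 b 0 * v c0 0 * A (a, b, c0) =
    (v^T *m mat3 A *m tensmx U2 U1) 0 (mxtens_index (j, i)) by [].
  under eq_bigr do rewrite exchange_big /=.
  rewrite exchange_big /=.
  rewrite -mulmxA mxE; apply: eq_bigr => c' _; rewrite !mxE mulr_sumr exchange_big /=.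
  rewrite -(sum_mxtens (fun b' a' => col i U1 a' 0 * col j U2 b' 0 * v c' 0 * A (a', b', c'))).
  by apply: eq_bigr => l _; rewrite !mxE mxtens_indexK /=; ring.
have M4 : tnormF (tucker A U1^T U2^T U3^T) ^+ 2 <= (r1 * r2 * r3)%:R * m ^+ 2.
  rewrite sqr_sqrtr; last by apply: sumr_ge0 => l _; exact: sqr_ge0.
  have -> : (r1 * r2 * r3)%N = #|{: 'I_r1 * 'I_r2 * 'I_r3}|.
    by rewrite !card_prod !card_ord.
  rewrite mulr_natl -sumr_const; apply: ler_sum => -[[i j] k] _.
  rewrite tucker_entry -real_normK ?num_real// ler_sqr ?nnegrE//.
  exact: H.
have Cm0 : 0 <= tangent_constant r1 r2 r3 * m.
  by rewrite mulr_ge0// addr_ge0// sqrtr_ge0.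
rewrite /tangent_norm -(ger0_norm Cm0) -sqrtr_sqr ler_sqrt ?sqr_ge0//.
apply: (@le_trans _ _ ((r3 * r2 + r1 * r3 + r2 * r1 + r1 * r2 * r3)%:R * m ^+ 2)).
  by rewrite !natrD !mulrDl; do 3 (apply: lerD => //).
rewrite exprMn ler_wpM2r ?sqr_ge0// /tangent_constant.
set x := Num.sqrt _; have x0 : 0 <= x := sqrtr_ge0 _.
rewrite -[leLHS]sqr_sqrtr// -/x; nra.
Qed.

End TangentNorm.

(** * The lower bound *)

Section LowerBound.
Context {R : realType} {p1 p2 p3 n r1 r2 r3 : nat}.
Context {d : measure_display} {Omega : measurableType d}.
Variable P : probability Omega R.
Variables (X : 'I_n -> {RV P >-> tensor R p1 p2 p3}) (xi : 'I_n -> {RV P >-> R}).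
Variables (sigma sigma_xi lam kappa alpha : R) (A : tensor R p1 p2 p3).
Hypotheses (sigma_gt0 : 0 < sigma) (sigma_xi_gt0 : 0 < sigma_xi) (n_gt0 : (0 < n)%N).
Hypothesis model : gaussian_design_noise X xi sigma sigma_xi.
Local Notation Th := (Theta r1 r2 r3 lam kappa).

Lemma expected_length_ge0 CI T : (0 <= expected_length X xi CI T)%E.
Proof.
by rewrite /expected_length; apply: expectation_ge0 => w; rewrite subr_ge0 lower_le_upper.
Qed.

(** The two signals are [lam] and [lam + tau] times the same unit rank-one tensor.
    For this [tau] the bound on one minus the Hellinger affinity is
    [a ^+ 2 * score_constant / 8], whatever [n], [sigma] and [sigma_xi]. *)
Lemma expected_length_rank_one (CI : interval_estimator) (a b : R)
    (V1 : 'M[R]_(p1, r1)) (V2 : 'M[R]_(p2, r2)) (V3 : 'M[R]_(p3, r3)) i j k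
    (tau := a * (sigma_xi / (sigma * Num.sqrt n%:R))) :
  0 < lam -> 0 < a -> 0 < b < 1 -> a ^+ 2 * score_constant / 8 <= b ^+ 2 ->
  lam + tau <= kappa * lam ->
  orthonormal_cols V1 -> orthonormal_cols V2 -> orthonormal_cols V3 ->
  3 * b <= (1 - 2 * alpha) / 2 ->
  valid_cis X xi alpha Th A CI ->
  ((tau * `|tdot (rank_one 1 (col i V1) (col j V2) (col k V3)) A|
     * ((1 - 2 * alpha) / 2))%:E
   <= ereal_sup [set expected_length X xi CI T | T in Th])%E.
Proof.
move=> lam0 a0 b01 ab lt o1 o2 o3 b3 v.
have sn0 : 0 < Num.sqrt (n%:R : R) by rewrite sqrtr_gt0 ltr0n.
have tau0 : 0 < tau by rewrite mulr_gt0// divr_gt0// mulr_gt0.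
pose e := rank_one 1 (col i V1) (col j V2) (col k V3).
pose T s := rank_one s (col i V1) (col j V2) (col k V3).
have ThT0 : Th (T lam).
  by apply: rank_one_Theta => //; rewrite lexx/= (le_trans _ lt)// lerDl ltW.
have ThT1 : Th (T (lam + tau)).
  by apply: rank_one_Theta => //; rewrite ?addr_gt0// lt andbT lerDl ltW.
have e1 : \sum_l e l ^+ 2 = 1 by apply: rank_one_unit; exact: orthonormal_unit.
have TE l : T (lam + tau) l = T lam l + tau * e l.
  by rewrite /T /e !ffunE mul1r mulrDl.
have tb : n%:R * (tau ^+ 2 * (score_constant * sigma ^+ 2) / (8 * sigma_xi ^+ 2)) <= b ^+ 2.
  apply: le_trans ab; rewrite le_eqVlt; apply/orP; left; apply/eqP.
  have -> : tau ^+ 2 = a ^+ 2 * (sigma_xi ^+ 2 / (sigma ^+ 2 * n%:R)).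
    by rewrite /tau exprMn expr_div_n exprMn sqr_sqrtr ?ler0n.
  have n0 : (n%:R : R) != 0 by rewrite pnatr_eq0 -lt0n.
  by field; rewrite n0 !gt_eqF.
have TV := fun B => @total_variation_regression R p1 p2 p3 n d Omega P X xi sigma sigma_xi
  sigma_xi_gt0 sigma_gt0 model (T lam) (T (lam + tau)) e tau b B e1 TE b01 tb.
have low := two_point_expected_length v ThT0 ThT1 TV.
apply: (@le_trans _ _ (expected_length X xi CI (T lam))); last first.
  by apply: ereal_sup_ubound; exists (T lam).
apply: le_trans low; rewrite lee_fin.
rewrite (tdot_rank_one_scale (lam + tau)) (tdot_rank_one_scale lam) -mulrBl.
rewrite [lam + tau]addrC addrK normrM gtr0_norm// ler_wpM2l//.
  by rewrite mulr_ge0// ltW.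
lra.
Qed.

End LowerBound.

Theorem theorem3p4 (R : realType) (alpha kappa c K : R) (r1 r2 r3 : nat)
  (halpha : 0 < alpha < 1 / 2) (hc : 0 < c) :
  exists c3 : R, 0 < c3 /\
  forall (n p1 p2 p3 : nat) (sigma sigma_xi lam : R),
    (0 < n)%N -> 0 < sigma -> 0 < sigma_xi -> sigma_xi <= K * sigma ->
    lam < kappa * lam -> c <= lam ->
  forall (d : measure_display) (Omega : measurableType d)
    (P : probability Omega R)
    (X : 'I_n -> {RV P >-> tensor R p1 p2 p3}) (xi : 'I_n -> {RV P >-> R}),
    gaussian_design_noise X xi sigma sigma_xi ->
  forall (R1 R2 R3 : nat) (A : tensor R p1 p2 p3),
    is_loading_tensor R1 R2 R3 A ->
  forall (G : tensor R r1 r2 r3) (U1 : 'M[R]_(p1, r1)) (U2 : 'M[R]_(p2, r2))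
    (U3 : 'M[R]_(p3, r3)),
    orthonormal_cols U1 -> orthonormal_cols U2 -> orthonormal_cols U3 ->
    Theta r1 r2 r3 lam kappa (tucker G U1 U2 U3) ->
  ((c3 * sigma_xi / (sigma * Num.sqrt n%:R) * tangent_norm G U1 U2 U3 A)%:E
   <= minimax_expected_length X xi alpha (Theta r1 r2 r3 lam kappa) A)%E.
Proof.
have [kappa1|kappa1] := leP kappa 1.
  (* [lam < kappa * lam] with [lam] positive forces [1 < kappa]. *)
  exists 1; split=> // n p1 p2 p3 sigma sigma_xi lam _ _ _ _ lk cl.
  by exfalso; have := lt_le_trans hc cl; nra.
(* With this [b] the total variation [3 * b] uses half of the margin
   [1 - 2 * alpha]. The first bound on [a] keeps the laws close; the second one
   keeps [lam + a * eps <= kappa * lam], as [eps <= K] and [c <= lam]. *)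
pose b : R := (1 - 2 * alpha) / 6.
have b01 : 0 < b < 1 by rewrite /b; lra.
have C0 : 1 <= @score_constant R.
  have e1 : 1 <= expR (1 / 2 : R) by rewrite -[leLHS]expR0 ler_expR; lra.
  by rewrite /score_constant; lra.
pose a : R := Num.min (b / score_constant) ((kappa - 1) * c / (`|K| + 1)).
have K0 : 0 < `|K| + 1 by rewrite ltr_wpDl.
have a0 : 0 < a.
  rewrite lt_min; apply/andP; split; apply: divr_gt0 => //.
  - by case/andP: b01.
  - by rewrite (lt_le_trans ltr01).
  - by rewrite mulr_gt0// subr_gt0.
have ab : a ^+ 2 * score_constant / 8 <= b ^+ 2.
  have a1 : a * score_constant <= b.
    by rewrite -ler_pdivlMr ?ge_min ?lexx// (lt_le_trans ltr01).
  have a2 : a <= b by apply: le_trans a1; rewrite ler_peMr// ltW.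
  have a3 : a * (a * score_constant) <= b * b.
    by apply: ler_pM => //; rewrite ?mulr_ge0// ltW// (lt_le_trans ltr01).
  have a4 : 0 <= a * (a * score_constant).
    by rewrite !mulr_ge0// ltW// (lt_le_trans ltr01).
  rewrite [b ^+ 2]expr2 [a ^+ 2]expr2 -(mulrA a); lra.
have aK : a * (`|K| + 1) <= (kappa - 1) * c.
  by rewrite -ler_pdivlMr// /a ge_min lexx orbT.
pose q : R := (1 - 2 * alpha) / 2.
have q0 : 0 < q by rewrite /q; lra.
have tc0 : 0 < @tangent_constant R r1 r2 r3 by rewrite ltr_wpDl.
exists (a * q / tangent_constant r1 r2 r3); split.
  by rewrite divr_gt0// mulr_gt0.
move=> n p1 p2 p3 sigma sigma_xi lam n0 s0 x0 xK lk cl d Omega P X xi model.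
move=> R1 R2 R3 A _ G U1 U2 U3 o1 o2 o3 ThT.
have lam0 : 0 < lam by exact: lt_le_trans cl.
set eps := sigma_xi / (sigma * Num.sqrt n%:R).
have sn1 : 1 <= Num.sqrt (n%:R : R) by rewrite -[leLHS]sqrtr1 ler_sqrt ?ler1n.
have eps0 : 0 < eps by rewrite divr_gt0// mulr_gt0// (lt_le_trans ltr01).
have epsK : eps <= `|K| + 1.
  rewrite ler_pdivrMr; last by rewrite mulr_gt0// (lt_le_trans ltr01).
  apply: (le_trans xK); have Kn := ler_norm K.
  apply: (@le_trans _ _ ((`|K| + 1) * sigma)); first by rewrite ler_pM2r//; lra.
  by rewrite ler_pM2l// ler_peMr// ltW.
have lt : lam + a * eps <= kappa * lam.
  have h1 : a * eps <= a * (`|K| + 1) by rewrite ler_pM2l.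
  have h2 : (kappa - 1) * c <= (kappa - 1) * lam by rewrite ler_wpM2l// subr_ge0 ltW.
  lra.
have b3 : 3 * b <= (1 - 2 * alpha) / 2 by rewrite /b; lra.
apply: le_ereal_inf_tmp => _ [CI v <-].
set L := ereal_sup _.
have bound (V1 : 'M[R]_(p1, r1)) (V2 : 'M[R]_(p2, r2)) (V3 : 'M[R]_(p3, r3)) i j k :
     orthonormal_cols V1 -> orthonormal_cols V2 -> orthonormal_cols V3 ->
    ((a * eps * `|tdot (rank_one 1 (col i V1) (col j V2) (col k V3)) A| * q)%:E <= L)%E.
  move=> w1 w2 w3.
  exact: (expected_length_rank_one s0 x0 n0 model i j k lam0 a0 b01 ab lt w1 w2 w3 b3 v).
have L0 : (0 <= L)%E.
  apply: (le_trans (expected_length_ge0 X xi CI (tucker G U1 U2 U3))).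
  by apply: ereal_sup_ubound; exists (tucker G U1 U2 U3).
case: L L0 bound => [l||] // L0 bound; last by rewrite leey.
rewrite lee_fin in L0.
have aeq : 0 < a * eps * q by apply: mulr_gt0 => //; exact: mulr_gt0.
have tn : tangent_norm G U1 U2 U3 A <=
    tangent_constant r1 r2 r3 * (l / (a * eps * q)).
  apply: tangent_norm_le => //; first by rewrite divr_ge0// ltW.
  move=> V1 V2 V3 i j k w1 w2 w3; have := bound V1 V2 V3 i j k w1 w2 w3.
  by rewrite lee_fin ler_pdivlMr// (mulrC _ (a * eps * q)) mulrAC.
rewrite lee_fin.
have -> : a * q / tangent_constant r1 r2 r3 * sigma_xi / (sigma * Num.sqrt n%:R) =
    (a * eps * q) / tangent_constant r1 r2 r3.
  by rewrite /eps; field; rewrite !gt_eqF// (lt_le_trans ltr01).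
rewrite -ler_pdivlMl ?divr_gt0//; apply: (le_trans tn).
by rewrite le_eqVlt; apply/orP; left; apply/eqP; field; rewrite !gt_eqF.
Qed.
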